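(* Let $\mathcal C$ be a pre-rigid symmetric monoidal category such that (i) the finite dual functor $(-)^\circ$ exists, and the embedding $\mathsf{Hopf}(\mathcal C)\subseteq\mathsf{Bimon}(\mathcal C)$ has a left adjoint $H_l$ and a right adjoint $H_r$; (ii) the morphisms $\alpha_M\otimes \mathrm{id}_N$ and $\theta_{M,N}$ are monomorphisms for all objects $M,N$; (iii) $\varkappa_H$ is a monomorphism in $\mathcal C$ for every Hopf monoid $H$. Let $A$ be an $\Omega$-magma in $\mathcal C$, let $U$ be a comonoid, and let $\rho_U\colon A\to A\otimes U$ be a tensor epimorphism defining on $A$ a structure of a $U$-comodule, such that the $U$-universal comeasuring monoid $\mathcal A^\square(\rho_U)$ and the $U^*$-universal measuring comonoid ${}_\square\mathcal C(\rho_U^\vee)$ exist. Let $\rho_U^{\mathbf{HCoact}}\colon A\to A\otimes\mathcal H^\square(\rho_U)$ be the universal coaction of the $U$-universal coacting Hopf monoid and $(\rho_U^\vee)^{\mathbf{HAct}}\colon{}_\square\mathcal H(\rho_U^\vee)\otimes A\to A$ the universal action of the $U^*$-universal acting Hopf monoid. Then $$\left(\rho_U^{\mathbf{HCoact}}\right)^\vee(\varkappa_{\mathcal H^\square(\rho_U)}\otimes \mathrm{id}_A)\colon\mathcal H^\square(\rho_U)^\circ\otimes A\to A$$ is an action, and the unique Hopf monoid homomorphism $\beta^{\mathbf{Hopf}}\colon\mathcal H^\square(\rho_U)^\circ\to{}_\square\mathcal H(\rho_U^\vee)$ such that $$(\rho_U^\vee)^{\mathbf{HAct}}(\beta^{\mathbf{Hopf}}\otimes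 \mathrm{id}_A)=\left(\rho_U^{\mathbf{HCoact}}\right)^\vee(\varkappa_{\mathcal H^\square(\rho_U)}\otimes \mathrm{id}_A)$$ is a Hopf monoid isomorphism.
   Context: Associativity and unit constraints are suppressed; $c$ is the symmetry and $\mathbf 1$ the monoidal unit; $\mathsf{Mon}(\mathcal C)$, $\mathsf{Comon}(\mathcal C)$, $\mathsf{Bimon}(\mathcal C)$, $\mathsf{Hopf}(\mathcal C)$ are the categories of monoids, comonoids, bimonoids and Hopf monoids in $\mathcal C$. $\Omega$-magmas. $\Omega$ is a fixed set with maps $s,t\colon\Omega\to\mathbb Z_{\geq 0}$. An $\Omega$-magma in $\mathcal C$ is an object $A$ with morphisms $\omega_A\colon A^{\otimes s(\omega)}\to A^{\otimes t(\omega)}$ for all $\omega\in\Omega$ ($A^{\otimes 0}=\mathbf 1$; no identities are required). Measurings. For a comonoid $(P,\Delta,\varepsilon)$ and $\psi_i\colon P\otimes A_i\to B_i$, put $\psi_1\tilde\otimes\psi_2=(\psi_1\otimes\psi_2)(\mathrm{id}_P\otimes c_{P,A_1}\otimes \mathrm{id}_{A_2})(\Delta\otimes \mathrm{id}_{A_1\otimes A_2})$; $\psi^{\tilde\otimes n}$ is the iterated product, $\psi^{\tilde\otimes 0}$ is $P\otimes\mathbf 1\cong P\xrightarrow{\varepsilon}\mathbf 1$. A measuring from $A$ to $B$ is a morphism $\psi\colon P\otimes A\to B$, $P$ a comonoid, with $\omega_B\,\psi^{\tilde\otimes s(\omega)}=\psi^{\tilde\otimes t(\omega)}(\mathrm{id}_P\otimes\omega_A)$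 for all $\omega$. Comeasurings. For a monoid $(Q,\mu,u)$ and $\rho_i\colon A_i\to B_i\otimes Q$, put $\rho_1\tilde\otimes\rho_2=(\mathrm{id}_{B_1\otimes B_2}\otimes\mu)(\mathrm{id}_{B_1}\otimes c_{Q,B_2}\otimes \mathrm{id}_Q)(\rho_1\otimes\rho_2)$; $\rho^{\tilde\otimes 0}$ is $\mathbf 1\xrightarrow{u}Q\cong\mathbf 1\otimes Q$. A comeasuring from $A$ to $B$ is a morphism $\rho\colon A\to B\otimes Q$, $Q$ a monoid, with $\rho^{\tilde\otimes t(\omega)}\omega_A=(\omega_B\otimes \mathrm{id}_Q)\rho^{\tilde\otimes s(\omega)}$ for all $\omega$. For a bimonoid $P$, an action of $P$ on $A$ is a measuring $P\otimes A\to A$ that is a left $P$-module structure; a coaction of $P$ on $A$ is a comeasuring $A\to A\otimes P$ that is a right $P$-comodule structure. Tensor epi/monomorphisms. $\rho\colon A\to B\otimes Q$ is a tensor epimorphism if $(\mathrm{id}_B\otimes f)\rho=(\mathrm{id}_B\otimes g)\rho$ implies $f=g$ for all $f,g\colon Q\to R$. $\psi\colon P\otimes A\to B$ is a tensor monomorphism if $\psi(f\otimes \mathrm{id}_A)=\psi(g\otimes \mathrm{id}_A)$ implies $f=g$ for all $f,g\colon R\to P$. Pre-rigidity. For every object $A$ there are a fixed object $A^*$ and morphism $\mathrm{ev}_A\colon A^*\otimes A\to\mathbf 1$ such that $f\mapsto \mathrm{ev}_A(f\otimes \mathrm{id}_A)$ is a bijection $\mathcal C(B,A^* )\to\mathcal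 C(B\otimes A,\mathbf 1)$ for every $B$. For $f\colon A\to B$, $f^*\colon B^*\to A^*$ is defined by $\mathrm{ev}_A(f^*\otimes \mathrm{id}_A)=\mathrm{ev}_B(\mathrm{id}_{B^*}\otimes f)$; $\theta_{A,B}\colon A^*\otimes B^*\to(A\otimes B)^*$ by $\mathrm{ev}_{A\otimes B}(\theta_{A,B}\otimes \mathrm{id}_{A\otimes B})=(\mathrm{ev}_A\otimes \mathrm{ev}_B)(\mathrm{id}_{A^*}\otimes c^{-1}_{A,B^*}\otimes \mathrm{id}_B)$; $\iota\colon\mathbf 1\to\mathbf 1^*$ by: $\mathrm{ev}_{\mathbf 1}(\iota\otimes \mathrm{id}_{\mathbf 1})$ is the canonical isomorphism $\mathbf 1\otimes\mathbf 1\cong\mathbf 1$; $\alpha_A\colon A\to A^{**}$ by $\mathrm{ev}_{A^*}(\alpha_A\otimes \mathrm{id}_{A^*})c_{A^*,A}=\mathrm{ev}_A$. For a comonoid $(C,\Delta,\varepsilon)$, $C^*$ is a monoid with multiplication $\Delta^*\theta_{C,C}$ and unit $\varepsilon^*\iota$. For $\rho\colon A\to B\otimes Q$, $\rho^\vee\colon Q^*\otimes A\to B$ is $(\mathrm{id}_B\otimes \mathrm{ev}_Q)(c_{Q^*,B}\otimes \mathrm{id}_Q)(\mathrm{id}_{Q^*}\otimes\rho)$. Finite dual. $(-)^\circ\colon\mathsf{Mon}(\mathcal C)\to\mathsf{Comon}(\mathcal C)$ is a contravariant functor with a natural bijection $\mathsf{Mon}(\mathcal C)(A,C^* )\cong\mathsf{Comon}(\mathcal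 C)(C,A^\circ)$. If $\eta_A\colon A\to A^{\circ*}$ corresponds to $\mathrm{id}_{A^\circ}$, then $\varkappa_A\colon A^\circ\to A^*$ is defined by $\mathrm{ev}_A(\varkappa_A\otimes \mathrm{id}_A)=\mathrm{ev}_{A^\circ}(\eta_A\otimes \mathrm{id}_{A^\circ})c_{A^\circ,A}$. If $\mathcal C$ is symmetric and $B$ is a bimonoid, then $B^\circ$ is a bimonoid: the multiplication $B^\circ\otimes B^\circ\to B^\circ$ is the comonoid homomorphism corresponding to the monoid homomorphism $\theta_{B^\circ,B^\circ}(\eta_B\otimes\eta_B)\Delta_B\colon B\to(B^\circ\otimes B^\circ)^*$ and the unit $\mathbf 1\to B^\circ$ corresponds to $\iota\varepsilon_B\colon B\to\mathbf 1^*$. If $H$ is a Hopf monoid and $\varkappa_H$ is a monomorphism, then the bimonoid $H^\circ$ is a Hopf monoid (known fact). Universal objects. For a tensor epimorphism $\rho_U\colon A\to A\otimes U$, $\mathcal A^\square(\rho_U)$ is the monoid of the initial object in the category of comeasurings $\rho\colon A\to A\otimes Q$ ($Q$ a monoid) such that $(\mathrm{id}_A\otimes\tau)\rho_U=\rho$ for some $\tau\colon U\to Q$ in $\mathcal C$ (morphisms: monoid homomorphisms $\varphi\colon Q_1\to Q_2$ with $(\mathrm{id}_A\otimes\varphi)\rho_1=\rho_2$). For a tensor monomorphism $\psi_V\colon V\otimes A\to A$, ${}_\square\mathcal C(\psi_V)$ is the comonoid of the terminal object in the category of measurings $\psi\colon P\otimes A\to A$ ($P$ a comonoid) such that $\psi=\psi_V(\tau\otimes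 \mathrm{id}_A)$ for some $\tau\colon P\to V$ in $\mathcal C$ (morphisms: comonoid homomorphisms $\varphi\colon P_1\to P_2$ with $\psi_2(\varphi\otimes \mathrm{id}_A)=\psi_1$). If $U$ is a comonoid and the tensor epimorphism $\rho_U$ is a $U$-comodule structure, $\rho_U^{\mathbf{HCoact}}\colon A\to A\otimes\mathcal H^\square(\rho_U)$ is the initial object in the category of coactions $\rho\colon A\to A\otimes H$ ($H$ a Hopf monoid) such that $(\mathrm{id}_A\otimes\tau)\rho_U=\rho$ for some comonoid homomorphism $\tau\colon U\to H$ (morphisms: Hopf monoid homomorphisms compatible with the coactions). If $V$ is a monoid and the tensor monomorphism $\psi_V$ is a $V$-module structure, $\psi_V^{\mathbf{HAct}}\colon{}_\square\mathcal H(\psi_V)\otimes A\to A$ is the terminal object in the category of actions $\psi\colon H\otimes A\to A$ ($H$ a Hopf monoid) such that $\psi=\psi_V(\tau\otimes \mathrm{id}_A)$ for some monoid homomorphism $\tau\colon H\to V$ (morphisms: Hopf monoid homomorphisms compatible with the actions). Under the hypotheses of the claim $\rho_U^\vee\colon U^*\otimes A\to A$ is a tensor monomorphism and a $U^*$-module structure, and (known results) these universal Hopf monoids exist: $\mathcal H^\square(\rho_U)=H_l(\mathcal B^\square(\rho_U))$ and ${}_\square\mathcal H(\rho_U^\vee)=H_r({}_\square\mathcal B(\rho_U^\vee))$, where the universal bimonoids $\mathcal B^\square(\rho_U)$, ${}_\square\mathcal B(\rho_U^\vee)$ are defined in the same way with bimonoids in place of Hopf monoids and equal $\mathcal A^\square(\rho_U)$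 as a monoid and ${}_\square\mathcal C(\rho_U^\vee)$ as a comonoid, respectively. *)

(* Defs.v *)
From mathcomp Require Import ssreflect ssrfun ssrbool.
From Stdlib Require Import ProofIrrelevance.

Set Implicit Arguments.
Unset Strict Implicit.
Unset Printing Implicit Defensive.

Record Category := {
  ob :> Type;
  hom : ob -> ob -> Type;
  idm : forall A, hom A A;
  compose : forall A B C, hom B C -> hom A B -> hom A C;
  compose_idl : forall A B (f : hom A B), compose (idm B) f = f;
  compose_idr : forall A B (f : hom A B), compose f (idm A) = f;
  compose_assoc : forall A B C D (h : hom C D) (g : hom B C) (f : hom A B),
    compose h (compose g f) = compose (compose h g) f
}.
Arguments idm {_} A.
Arguments compose {_ A B C}.

Declare Scope cat_scope.
Delimit Scope cat_scope with cat.
Open Scope cat_scope.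
Notation "A ~> B" := (hom A B) (at level 60, no associativity) : cat_scope.
Notation "g ∘ f" := (compose g f) (at level 42, left associativity) : cat_scope.

Definition mono (C : Category) (A B : C) (f : A ~> B) : Prop :=
  forall (X : C) (g h : X ~> A), f ∘ g = f ∘ h -> g = h.

Definition is_iso (C : Category) (A B : C) (f : A ~> B) : Prop :=
  exists g : B ~> A, g ∘ f = idm A /\ f ∘ g = idm B.

Definition opposite (C : Category) : Category := {|
  ob := C;
  hom := fun A B => B ~> A;
  idm := fun A => idm A;
  compose := fun A B D g f => f ∘ g;
  compose_idl := fun A B f => compose_idr f;
  compose_idr := fun A B f => compose_idl f;
  compose_assoc := fun A B D E h g f => esym (compose_assoc f g h)
|}.

Record Functor (C D : Category) := {
  fob :> C -> D;
  fmap : forall A B, (A ~> B) -> (fob A ~> fob B);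
  fmap_id : forall A, fmap (idm A) = idm (fob A);
  fmap_comp : forall A B E (g : B ~> E) (f : A ~> B),
    fmap (g ∘ f) = fmap g ∘ fmap f
}.
Arguments fmap {C D} _ {A B}.

Record Adjunction (C D : Category) (L : Functor C D) (R : Functor D C) := {
  adj : forall (X : C) (Y : D), (L X ~> Y) -> (X ~> R Y);
  adj_inv : forall (X : C) (Y : D), (X ~> R Y) -> (L X ~> Y);
  adjK : forall X Y, cancel (@adj X Y) (@adj_inv X Y);
  adj_invK : forall X Y, cancel (@adj_inv X Y) (@adj X Y);
  adj_natural : forall X' X Y Y' (f : X' ~> X) (g : Y ~> Y') (h : L X ~> Y),
    adj (g ∘ h ∘ fmap L f) = fmap R g ∘ adj h ∘ f
}.

Arguments adj {C D L R} _ {X Y} _.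
Arguments adj_inv {C D L R} _ {X Y} _.

Record SymMonCat := {
  smc_cat :> Category;
  tens : smc_cat -> smc_cat -> smc_cat;
  tensm : forall A B A' B' : smc_cat,
    (A ~> A') -> (B ~> B') -> (tens A B ~> tens A' B');
  tens_id : forall A B, tensm (idm A) (idm B) = idm (tens A B);
  tens_comp : forall A B A' B' A'' B'' (f' : A' ~> A'') (f : A ~> A')
      (g' : B' ~> B'') (g : B ~> B'),
    tensm (f' ∘ f) (g' ∘ g) = tensm f' g' ∘ tensm f g;
  munit : smc_cat;
  assoc : forall A B C, tens (tens A B) C ~> tens A (tens B C);
  assoc_inv : forall A B C, tens A (tens B C) ~> tens (tens A B) C;
  assocK : forall A B C, assoc_inv A B C ∘ assoc A B C = idm _;
  assoc_invK : forall A B C, assoc A B C ∘ assoc_inv A B C = idm _;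
  assoc_natural : forall A B C A' B' C' (f : A ~> A') (g : B ~> B') (h : C ~> C'),
    assoc A' B' C' ∘ tensm (tensm f g) h = tensm f (tensm g h) ∘ assoc A B C;
  lunit : forall A, tens munit A ~> A;
  lunit_inv : forall A, A ~> tens munit A;
  lunitK : forall A, lunit_inv A ∘ lunit A = idm _;
  lunit_invK : forall A, lunit A ∘ lunit_inv A = idm _;
  lunit_natural : forall A B (f : A ~> B),
    lunit B ∘ tensm (idm munit) f = f ∘ lunit A;
  runit : forall A, tens A munit ~> A;
  runit_inv : forall A, A ~> tens A munit;
  runitK : forall A, runit_inv A ∘ runit A = idm _;
  runit_invK : forall A, runit A ∘ runit_inv A = idm _;
  runit_natural : forall A B (f : A ~> B),
    runit B ∘ tensm f (idm munit) = f ∘ runit A;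
  pentagon : forall A B C D,
    tensm (idm A) (assoc B C D) ∘ assoc A (tens B C) D ∘ tensm (assoc A B C) (idm D)
    = assoc A B (tens C D) ∘ assoc (tens A B) C D;
  triangle : forall A B,
    tensm (idm A) (lunit B) ∘ assoc A munit B = tensm (runit A) (idm B);
  symm : forall A B, tens A B ~> tens B A;
  symm_natural : forall A B A' B' (f : A ~> A') (g : B ~> B'),
    symm A' B' ∘ tensm f g = tensm g f ∘ symm A B;
  symmK : forall A B, symm B A ∘ symm A B = idm _;
  hexagon : forall A B C,
    assoc B C A ∘ symm A (tens B C) ∘ assoc A B C
    = tensm (idm B) (symm A C) ∘ assoc B A C ∘ tensm (symm A B) (idm C)
}.
Arguments munit {_}.
Arguments tens {_}.
Arguments tensm {_ A B A' B'}.
Arguments assoc {_}.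
Arguments assoc_inv {_}.
Arguments lunit {_}.
Arguments lunit_inv {_}.
Arguments runit {_}.
Arguments runit_inv {_}.
Arguments symm {_}.

Notation "A ⊗ B" := (tens A B) (at level 40, left associativity) : cat_scope.
Notation "f ⊠ g" := (tensm f g) (at level 40, left associativity) : cat_scope.
Notation "𝟏" := munit : cat_scope.

(* The middle-four interchange id ⊗ c ⊗ id, with the associators made explicit.
   It is locked so that rewriting with associativity does not unfold it. *)
Definition swap4 (C : SymMonCat) (A B X Y : C) :
    (A ⊗ B) ⊗ (X ⊗ Y) ~> (A ⊗ X) ⊗ (B ⊗ Y) :=
  locked (assoc_inv A X (B ⊗ Y)
          ∘ (idm A ⊠ (assoc X B Y ∘ (symm B X ⊠ idm Y) ∘ assoc_inv B X Y))
          ∘ assoc A B (X ⊗ Y)).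

Section Coherence.
Variable C : SymMonCat.
Implicit Types A B D E X Y Z N : C.

Lemma compA A B X Y (h : X ~> Y) (g : B ~> X) (f : A ~> B) :
  h ∘ (g ∘ f) = h ∘ g ∘ f.
Proof. exact: compose_assoc. Qed.

Lemma tens_split A B A' B' (f : A ~> A') (g : B ~> B') :
  f ⊠ g = (f ⊠ idm _) ∘ (idm _ ⊠ g).
Proof. by rewrite -tens_comp compose_idl compose_idr. Qed.
Lemma tens_split' A B A' B' (f : A ~> A') (g : B ~> B') :
  f ⊠ g = (idm _ ⊠ g) ∘ (f ⊠ idm _).
Proof. by rewrite -tens_comp compose_idl compose_idr. Qed.
Lemma tcr X A B D (f : A ~> B) (g : B ~> D) :
  idm X ⊠ (g ∘ f) = (idm X ⊠ g) ∘ (idm X ⊠ f).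
Proof. by rewrite -tens_comp compose_idl. Qed.
Lemma tcl X A B D (f : A ~> B) (g : B ~> D) :
  (g ∘ f) ⊠ idm X = (g ⊠ idm X) ∘ (f ⊠ idm X).
Proof. by rewrite -tens_comp compose_idl. Qed.

Lemma epi_assoc X Y A B (f g : X ⊗ (Y ⊗ A) ~> B) :
  f ∘ assoc X Y A = g ∘ assoc X Y A -> f = g.
Proof.
by move=> e; rewrite -(compose_idr f) -(compose_idr g) -assoc_invK !compA e.
Qed.

Lemma tens_unit_faithful A B (f g : A ~> B) : idm 𝟏 ⊠ f = idm 𝟏 ⊠ g -> f = g.
Proof.
move=> e; rewrite -(compose_idr f) -(compose_idr g) -(lunit_invK A) !compA.
by rewrite -!lunit_natural e.
Qed.
Lemma tens_unit_faithful' A B (f g : A ~> B) : f ⊠ idm 𝟏 = g ⊠ idm 𝟏 -> f = g.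
Proof.
move=> e; rewrite -(compose_idr f) -(compose_idr g) -(runit_invK A) !compA.
by rewrite -!runit_natural e.
Qed.

Lemma assoc_nat1 A A' B D (f : A ~> A') :
  assoc A' B D ∘ ((f ⊠ idm B) ⊠ idm D) = (f ⊠ idm _) ∘ assoc A B D.
Proof. by rewrite assoc_natural tens_id. Qed.
Lemma assoc_nat2 A B B' D (f : B ~> B') :
  assoc A B' D ∘ ((idm A ⊠ f) ⊠ idm D) = (idm A ⊠ (f ⊠ idm D)) ∘ assoc A B D.
Proof. by rewrite assoc_natural. Qed.
Lemma assoc_nat3 A B D D' (f : D ~> D') :
  assoc A B D' ∘ (idm (A ⊗ B) ⊠ f) = (idm A ⊠ (idm B ⊠ f)) ∘ assoc A B D.
Proof. by rewrite -tens_id assoc_natural. Qed.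

Lemma lunit_tens A B : lunit (A ⊗ B) ∘ assoc 𝟏 A B = lunit A ⊠ idm B.
Proof.
apply: tens_unit_faithful; rewrite tcr.
have ep W (f g : 𝟏 ⊗ ((𝟏 ⊗ A) ⊗ B) ~> W) :
    f ∘ assoc _ _ _ ∘ (assoc 𝟏 𝟏 A ⊠ idm B) = g ∘ assoc _ _ _ ∘ (assoc 𝟏 𝟏 A ⊠ idm B) -> f = g.
  move=> e; apply: epi_assoc.
  rewrite -[LHS]compose_idr -[RHS]compose_idr -tens_id -assoc_invK tcl !compA.
  by rewrite e.
apply: ep; rewrite -!compA [in LHS](compA (idm 𝟏 ⊠ assoc _ _ _)) pentagon !compA.
rewrite triangle -assoc_nat1 -triangle tcl !compA.
by rewrite assoc_nat2 -!compA.
Qed.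

Lemma runit_tens A B : (idm A ⊠ runit B) ∘ assoc A B 𝟏 = runit (A ⊗ B).
Proof.
apply: tens_unit_faithful'; rewrite tcl.
have mo (f g : ((A ⊗ B) ⊗ 𝟏) ⊗ 𝟏 ~> (A ⊗ B) ⊗ 𝟏) : 
    assoc _ _ _ ∘ f = assoc _ _ _ ∘ g -> f = g.
  by move=> e; rewrite -(compose_idl f) -(compose_idl g) -assocK -!compA e.
apply: mo; rewrite compA assoc_nat2 -(triangle (A ⊗ B)) -(triangle B).
rewrite compA assoc_nat3 tcr -!compA; congr (_ ∘ _).
by rewrite !compA pentagon.
Qed.

Lemma lunit_runit : lunit 𝟏 = runit (𝟏 : C).
Proof.
apply: tens_unit_faithful'.
rewrite -triangle -lunit_tens; congr (_ ∘ _).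
have := lunit_natural (lunit (𝟏 : C)) => e.
by rewrite -(compose_idl (lunit _)) -(lunitK 𝟏) -compA -e compA lunitK compose_idl.
Qed.

Lemma symm_unit A : lunit A ∘ symm A 𝟏 = runit A.
Proof.
apply: tens_unit_faithful'.
have mo (f g : (A ⊗ 𝟏) ⊗ 𝟏 ~> A ⊗ 𝟏) : symm _ _ ∘ f = symm _ _ ∘ g -> f = g.
  by move=> e; rewrite -(compose_idl f) -(compose_idl g) -(symmK A) -!compA e.
apply: mo.
rewrite -(triangle A) compA (symm_natural (idm A)) -(lunit_tens 𝟏 A) -!compA.
rewrite [assoc 𝟏 𝟏 A ∘ (_ ∘ _)]compA hexagon.
rewrite !compA lunit_natural tcl compA; congr (_ ∘ _).
by rewrite -compA lunit_tens.
Qed.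
End Coherence.

Section Strict.
Variable C : SymMonCat.

Definition Sw (X Y N : C) : X ⊗ (Y ⊗ N) ~> Y ⊗ (X ⊗ N) :=
  locked (assoc _ _ _ ∘ (symm _ _ ⊠ idm _) ∘ assoc_inv _ _ _).

Lemma assoc_inv_natural (A B D A' B' D' : C) (f : A ~> A') (g : B ~> B') (h : D ~> D') :
  assoc_inv A' B' D' ∘ (f ⊠ (g ⊠ h)) = ((f ⊠ g) ⊠ h) ∘ assoc_inv A B D.
Proof.
rewrite -(compose_idr (_ ∘ (f ⊠ (g ⊠ h)))) -assoc_invK !compA.
rewrite -[_ ∘ _ ∘ assoc A B D]compA -assoc_natural.
by rewrite !compA assocK compose_idl.
Qed.
Lemma Sw_natural (X Y N X' Y' N' : C) (f : X ~> X') (g : Y ~> Y') (h : N ~> N') :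
  Sw _ _ _ ∘ (f ⊠ (g ⊠ h)) = (g ⊠ (f ⊠ h)) ∘ Sw _ _ _.
Proof.
rewrite /Sw -!lock -!compA assoc_inv_natural ![_ ∘ (_ ∘ assoc_inv _ _ _)]compA -tens_comp.
rewrite symm_natural !compose_idl !compA.
by rewrite -assoc_natural -[_ ∘ _ ∘ (symm _ _ ⊠ _)]compA -tens_comp !compose_idr.
Qed.
Lemma SwK (X Y N : C) : Sw Y X N ∘ Sw X Y N = idm _.
Proof.
rewrite /Sw -!lock !compA.
have e (Z W V : C) T (k : _ ~> T) : k ∘ assoc_inv Z W V ∘ assoc Z W V = k.
  by rewrite -compA assocK compose_idr.
by rewrite e -[_ ∘ _ ∘ (_ ⊠ _)]compA -tens_comp symmK compose_idl tens_id compose_idr assoc_invK.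
Qed.
End Strict.

Lemma asK (C : SymMonCat) (Z W V T : C) (k : _ ~> T) : k ∘ assoc_inv Z W V ∘ assoc Z W V = k.
Proof. by rewrite -compA assocK compose_idr. Qed.
Lemma asK' (C : SymMonCat) (Z W V T : C) (k : _ ~> T) : k ∘ assoc Z W V ∘ assoc_inv Z W V = k.
Proof. by rewrite -compA assoc_invK compose_idr. Qed.

Section Strict2.
Variable C : SymMonCat.
Implicit Types X Y N : C.
Lemma Sw_assoc X Y N : Sw X Y N ∘ assoc X Y N = assoc Y X N ∘ (symm X Y ⊠ idm N).
Proof. by rewrite /Sw -!lock asK. Qed.

Lemma Sw_unitl Y N : (idm Y ⊠ lunit N) ∘ Sw 𝟏 Y N = lunit (Y ⊗ N).
Proof.
rewrite /Sw -!lock !compA triangle -tcl -symm_unit -[lunit Y ∘ _ ∘ _]compA symmK compose_idr.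
by rewrite -lunit_tens asK'.
Qed.

Lemma Sw_tensr X Y Z N :
  (assoc Y Z (X ⊗ N)) ∘ Sw X (Y ⊗ Z) N =
  (idm Y ⊠ Sw X Z N) ∘ Sw X Y (Z ⊗ N) ∘ (idm X ⊠ assoc Y Z N).
Proof.
have ep T (f g : X ⊗ ((Y ⊗ Z) ⊗ N) ~> T) : f ∘ assoc _ _ _ ∘ (assoc _ _ _ ⊠ idm _) = g ∘ assoc _ _ _ ∘ (assoc _ _ _ ⊠ idm _) -> f = g.
  move=> e; apply: epi_assoc.
  rewrite -[LHS]compose_idr -[RHS]compose_idr -tens_id -assoc_invK tcl !compA.
  by rewrite e.
apply: ep.
rewrite -[_ ∘ _ ∘ assoc X (Y ⊗ Z) N]compA Sw_assoc.
rewrite !compA -pentagon -!compA -!tcl !compA hexagon.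
have pent W (k : _ ~> W) : k ∘ (idm X ⊠ assoc Y Z N) ∘ assoc X (Y ⊗ Z) N ∘ (assoc X Y Z ⊠ idm N) = k ∘ assoc _ _ _ ∘ assoc _ _ _.
  by rewrite -!compA [(idm X ⊠ _) ∘ (_ ∘ _)]compA pentagon.
rewrite pent -[_ ∘ Sw _ _ _ ∘ _]compA Sw_assoc compA -[RHS]compA -assoc_nat1.
rewrite !compA -[_ ∘ assoc Y X _ ∘ assoc _ _ _]compA -pentagon !compA -tcr Sw_assoc tcr.
rewrite -[_ ∘ _ ∘ assoc Y _ _ in RHS]compA -assoc_nat2 !tcl.
by rewrite !compA.
Qed.

Lemma Sw_tensl X Z Y N :
  (idm Y ⊠ assoc X Z N) ∘ Sw (X ⊗ Z) Y N =
  Sw X Y (Z ⊗ N) ∘ (idm X ⊠ Sw Z Y N) ∘ assoc X Z (Y ⊗ N).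
Proof.
rewrite -[assoc X Z (Y ⊗ N)]compose_idr -(SwK _ Y).
rewrite [assoc _ _ _ ∘ (_ ∘ _)]compA Sw_tensr !compA.
rewrite -[_ ∘ (idm X ⊠ _) ∘ (idm X ⊠ _)]compA -tcr SwK tens_id compose_idr.
by rewrite SwK compose_idl.
Qed.

Lemma Sw_unitr X N : lunit (X ⊗ N) ∘ Sw X 𝟏 N = idm X ⊠ lunit N.
Proof.
by rewrite -Sw_unitl -compA SwK compose_idr.
Qed.

(* Coherence by reflection: a formal morphism over formal objects is evaluated
   both in [C] ([mval]) and on right-nested tensor products ([mnf]), where
   associators and unitors become identities and symmetries become composites of
   adjacent transpositions [Sw]; see [mnfP] and [strictP]. *)
Inductive oexp := oa of C | o1 | ot of oexp & oexp.
Fixpoint oval e : C := match e with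
  oa A => A | o1 => 𝟏 | ot x y => oval x ⊗ oval y end.
Fixpoint nf e N : C := match e with
  oa A => A ⊗ N | o1 => N | ot x y => nf x (nf y N) end.
Fixpoint nfm e N N' (h : N ~> N') : nf e N ~> nf e N' := match e with
  oa A => idm A ⊠ h | o1 => h | ot x y => nfm x (nfm y h) end.
Fixpoint norm e N : oval e ⊗ N ~> nf e N := match e with
  oa A => idm _ | o1 => lunit N
  | ot x y => norm x (nf y N) ∘ (idm _ ⊠ norm y N) ∘ assoc _ _ _ end.
Fixpoint normi e N : nf e N ~> oval e ⊗ N := match e with
  oa A => idm _ | o1 => lunit_inv N
  | ot x y => assoc_inv _ _ _ ∘ (idm _ ⊠ normi y N) ∘ normi x (nf y N) end.

Lemma nfm_id e N : nfm e (idm N) = idm _.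
Proof. by elim: e N => [A|//|x IHx y IHy] N /=; rewrite ?tens_id ?IHy. Qed.
Lemma nfm_comp e N N' N'' (g : N' ~> N'') (f : N ~> N') : nfm e (g ∘ f) = nfm e g ∘ nfm e f.
Proof.
by elim: e N N' N'' g f => [A|//|x IHx y IHy] N N' N'' g f /=; rewrite ?tcr ?IHy.
Qed.
Lemma norm_nat e N N' (h : N ~> N') : norm e N' ∘ (idm _ ⊠ h) = nfm e h ∘ norm e N.
Proof.
elim: e N N' h => [A||x IHx y IHy] N N' h /=.
- by rewrite compose_idl compose_idr.
- by rewrite lunit_natural.
- rewrite -compA assoc_nat3 compA -[norm x _ ∘ _ ∘ _]compA -tcr IHy tcr.
  by rewrite !compA IHx.
Qed.
Lemma normK e N : norm e N ∘ normi e N = idm _.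
Proof.
elim: e N => [A||x IHx y IHy] N /=; rewrite ?compose_idl ?lunit_invK //.
rewrite !compA asK' -[_ ∘ (idm _ ⊠ _) ∘ (idm _ ⊠ _)]compA -tcr IHy tens_id compose_idr.
exact: IHx.
Qed.
Lemma normiK e N : normi e N ∘ norm e N = idm _.
Proof.
elim: e N => [A||x IHx y IHy] N /=; rewrite ?compose_idl ?lunitK //.
rewrite !compA -[_ ∘ normi x _ ∘ norm x _]compA IHx compose_idr.
by rewrite -[_ ∘ _ ∘ (idm _ ⊠ _)]compA -tcr IHy tens_id compose_idr assocK.
Qed.

Fixpoint swa (A : C) y N : A ⊗ nf y N ~> nf y (A ⊗ N) := match y with
  oa B => Sw A B N | o1 => idm _
  | ot y1 y2 => nfm y1 (swa A y2 N) ∘ swa A y1 (nf y2 N) end.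
Fixpoint swp x y N : nf x (nf y N) ~> nf y (nf x N) := match x with
  oa A => swa A y N | o1 => idm _
  | ot x1 x2 => swp x1 y (nf x2 N) ∘ nfm x1 (swp x2 y N) end.

Lemma swaP A y N :
  norm y (A ⊗ N) ∘ Sw A (oval y) N = swa A y N ∘ (idm A ⊠ norm y N).
Proof.
elim: y N => [B||y1 IH1 y2 IH2] N /=.
- by rewrite tens_id compose_idl compose_idr.
- by rewrite Sw_unitr compose_idl.
- rewrite -compA Sw_tensr !tcr !compA; congr (_ ∘ _).
  rewrite -[_ ∘ (idm _ ⊠ norm y2 _) ∘ (idm _ ⊠ _)]compA -tcr IH2 tcr.
  rewrite !compA norm_nat -[_ ∘ _ ∘ Sw _ _ _]compA -Sw_natural !compA.
  by rewrite -[_ ∘ norm y1 _ ∘ Sw _ _ _]compA IH1 !compA.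
Qed.

Lemma swpP x y N :
  norm y (nf x N) ∘ (idm _ ⊠ norm x N) ∘ Sw (oval x) (oval y) N =
  swp x y N ∘ norm x (nf y N) ∘ (idm _ ⊠ norm y N).
Proof.
elim: x N => [A||x1 IH1 x2 IH2] N /=.
- by rewrite tens_id !compose_idr swaP.
- by rewrite -compA Sw_unitl compose_idl lunit_natural.
- rewrite !tcr !compA -[_ ∘ _ ∘ Sw _ _ _]compA Sw_tensl !compA.
  rewrite -[_ ∘ _ ∘ Sw _ _ _]compA -Sw_natural compA IH1.
  rewrite -[RHS]compA assoc_nat3 !compA; congr (_ ∘ _).
  rewrite -[_ ∘ _ ∘ norm x1 _]compA -norm_nat !compA.
  by rewrite -!compA -!tcr !compA IH2.
Qed.

Inductive mexp : oexp -> oexp -> Type :=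
| mid x : mexp x x
| mcomp x y z : mexp y z -> mexp x y -> mexp x z
| mtens x y x' y' : mexp x x' -> mexp y y' -> mexp (ot x y) (ot x' y')
| ma x y z : mexp (ot (ot x y) z) (ot x (ot y z))
| mai x y z : mexp (ot x (ot y z)) (ot (ot x y) z)
| ml x : mexp (ot o1 x) x
| mli x : mexp x (ot o1 x)
| mr x : mexp (ot x o1) x
| mri x : mexp x (ot x o1)
| mc x y : mexp (ot x y) (ot y x)
| mg x y : (oval x ~> oval y) -> mexp x y.

Fixpoint mval x y (m : mexp x y) : oval x ~> oval y := match m with
| mid x => idm _
| mcomp _ _ _ g f => mval g ∘ mval f
| mtens _ _ _ _ f g => mval f ⊠ mval g
| ma x y z => assoc _ _ _
| mai x y z => assoc_inv _ _ _
| ml x => lunit _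
| mli x => lunit_inv _
| mr x => runit _
| mri x => runit_inv _
| mc x y => symm _ _
| mg x y f => f
end.

Definition gen x y (f : oval x ~> oval y) N : nf x N ~> nf y N :=
  norm y N ∘ (f ⊠ idm N) ∘ normi x N.

Fixpoint mnf x y (m : mexp x y) N : nf x N ~> nf y N := match m with
| mid x => idm _
| mcomp _ _ _ g f => mnf g N ∘ mnf f N
| mtens x y x' y' f g => mnf f (nf y' N) ∘ nfm x (mnf g N)
| ma x y z => idm _
| mai x y z => idm _
| ml x => idm _
| mli x => idm _
| mr x => idm _
| mri x => idm _
| mc x y => swp x y N
| mg x y f => gen f N
end.

Lemma norm_assoc x y z N :
  norm (ot x (ot y z)) N ∘ (assoc _ _ _ ⊠ idm N) = norm (ot (ot x y) z) N.
Proof.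
rewrite /= tcr tcr !compA -[_ ∘ assoc _ (oval y ⊗ _) _]compA.
rewrite -!compA; congr (_ ∘ _); rewrite [(idm _ ⊠ assoc _ _ _) ∘ _]compA pentagon.
by congr (_ ∘ _); rewrite !compA assoc_nat3.
Qed.
Lemma norm_runit x N : norm x N ∘ (runit _ ⊠ idm N) = norm (ot x o1) N.
Proof. by rewrite /= -triangle compA. Qed.
Lemma norm_lunit x N : norm x N ∘ (lunit _ ⊠ idm N) = norm (ot o1 x) N.
Proof. by rewrite /= lunit_natural -compA lunit_tens. Qed.

Lemma mnfP x y (m : mexp x y) N : norm y N ∘ (mval m ⊠ idm N) = mnf m N ∘ norm x N.
Proof.
elim: m N => {x y}
  [x|x y z g IHg f IHf|x y x' y' f IHf g IHg|x y z|x y z|x|x|x|x|x y|x y f] N.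
- by rewrite /= tens_id compose_idl compose_idr.
- by rewrite /= tcl compA IHg -compA IHf compA.
- rewrite /= -[_ ∘ _ ∘ assoc _ _ _ ∘ _]compA assoc_natural !compA; congr (_ ∘ _).
  rewrite -!compA -tens_comp compose_idl IHg tens_split tcr !compA.
  by rewrite IHf -[_ ∘ _ ∘ (idm _ ⊠ mnf _ _)]compA norm_nat !compA.
- by rewrite norm_assoc compose_idl.
- by rewrite -norm_assoc -compA -tcl assoc_invK tens_id compose_idl compose_idr.
- by rewrite norm_lunit compose_idl.
- by rewrite -norm_lunit -compA -tcl lunit_invK tens_id compose_idl compose_idr.
- by rewrite norm_runit compose_idl.
- by rewrite -norm_runit -compA -tcl runit_invK tens_id compose_idl compose_idr.
- by rewrite /= -compA -Sw_assoc !compA swpP.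
- by rewrite /= /gen -[RHS]compA normiK compose_idr.
Qed.

Lemma strictP x y (m m' : mexp x y) : mnf m 𝟏 = mnf m' 𝟏 -> mval m = mval m'.
Proof.
move=> e; apply: tens_unit_faithful'.
rewrite -[LHS]compose_idl -[RHS]compose_idl -normiK -!compA.
by rewrite !mnfP e.
Qed.
End Strict2.

(* [strict C] proves equations between structural morphisms of [C]: after
   [strictP], words in [Sw] are sorted using naturality, [SwK] and the braid
   relation. *)
Ltac robj C X := lazymatch X with
  | @tens _ ?A ?B => let a := robj C A in let b := robj C B in constr:(@ot C a b)
  | @munit _ => constr:(@o1 C)
  | _ => constr:(@oa C X) end.
Ltac rmor C f := lazymatch f with
  | @idm _ ?A => let a := robj C A in constr:(@mid C a)
  | @compose _ ?A ?B ?D ?g ?h => let g' := rmor C g in let h' := rmor C h in constr:(mcomp g' h')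
  | @tensm _ _ _ _ _ ?g ?h => let g' := rmor C g in let h' := rmor C h in constr:(mtens g' h')
  | @assoc _ ?A ?B ?D => let a := robj C A in let b := robj C B in let d := robj C D in constr:(@ma C a b d)
  | @assoc_inv _ ?A ?B ?D => let a := robj C A in let b := robj C B in let d := robj C D in constr:(@mai C a b d)
  | @lunit _ ?A => let a := robj C A in constr:(@ml C a)
  | @lunit_inv _ ?A => let a := robj C A in constr:(@mli C a)
  | @runit _ ?A => let a := robj C A in constr:(@mr C a)
  | @runit_inv _ ?A => let a := robj C A in constr:(@mri C a)
  | @symm _ ?A ?B => let a := robj C A in let b := robj C B in constr:(@mc C a b)
  | _ => lazymatch type of f with @hom _ ?A ?B =>
    let a := robj C A in let b := robj C B in constr:(@mg C a b f) end
  end.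

Section Rules.
Variable C : SymMonCat.
Implicit Types A B D X Y Z N : C.

Lemma Sw_braid A B D N :
  Sw A B (D ⊗ N) ∘ ((idm A ⊠ Sw D B N) ∘ Sw D A (B ⊗ N))
  = (idm B ⊠ Sw D A N) ∘ (Sw D B (A ⊗ N) ∘ (idm D ⊠ Sw A B N)).
Proof.
have h : assoc A D (B ⊗ N) ∘ (symm D A ⊠ idm (B ⊗ N)) ∘ assoc_inv D A (B ⊗ N) = Sw D A (B ⊗ N).
  by rewrite /Sw -lock.
have e := Sw_tensl A D B N.
rewrite -h !compA -e -[_ ∘ Sw _ _ _ ∘ _]compA.
rewrite -(tens_id B N) Sw_natural compA -tcr -Sw_assoc tcr.
by rewrite -![_ ∘ (idm B ⊠ assoc _ _ _) ∘ _]compA Sw_tensl !compA asK'.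
Qed.

Lemma rM X Z Z' Z'' W (f : Z' ~> Z'') (g : Z ~> Z') (k : W ~> X ⊗ Z) :
  (idm X ⊠ f) ∘ ((idm X ⊠ g) ∘ k) = (idm X ⊠ (f ∘ g)) ∘ k.
Proof. by rewrite tcr compA. Qed.
Lemma r1 A B N W (k : W ~> A ⊗ (B ⊗ N)) : Sw B A N ∘ (Sw A B N ∘ k) = k.
Proof. by rewrite compA SwK compose_idl. Qed.
Lemma r2a A B N N' (h : N ~> N') :
  Sw A B N' ∘ (idm A ⊠ (idm B ⊠ h)) = (idm B ⊠ (idm A ⊠ h)) ∘ Sw A B N.
Proof. exact: Sw_natural. Qed.
Lemma r2b A B N N' (h : N ~> N') W (k : W ~> _) :
  Sw A B N' ∘ ((idm A ⊠ (idm B ⊠ h)) ∘ k) = (idm B ⊠ (idm A ⊠ h)) ∘ (Sw A B N ∘ k).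
Proof. by rewrite compA r2a compA. Qed.
Lemma r2c A B N N' (h : N ~> N') Z (r : Z ~> _) :
  Sw A B N' ∘ (idm A ⊠ ((idm B ⊠ h) ∘ r)) =
  (idm B ⊠ (idm A ⊠ h)) ∘ (Sw A B N ∘ (idm A ⊠ r)).
Proof. by rewrite tcr r2b. Qed.
Lemma r2d A B N N' (h : N ~> N') Z (r : Z ~> _) W (k : W ~> _) :
  Sw A B N' ∘ ((idm A ⊠ ((idm B ⊠ h) ∘ r)) ∘ k) =
  (idm B ⊠ (idm A ⊠ h)) ∘ (Sw A B N ∘ ((idm A ⊠ r) ∘ k)).
Proof. by rewrite tcr -compA r2b. Qed.
Lemma r3a A B D N W (k : W ~> _) :
  Sw A B (D ⊗ N) ∘ ((idm A ⊠ Sw D B N) ∘ (Sw D A (B ⊗ N) ∘ k))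
  = (idm B ⊠ Sw D A N) ∘ (Sw D B (A ⊗ N) ∘ ((idm D ⊠ Sw A B N) ∘ k)).
Proof. by have := Sw_braid A B D N; rewrite !compA => ->. Qed.
Lemma r3b A B D N Z (q : Z ~> B ⊗ N) :
  Sw A B (D ⊗ N) ∘ ((idm A ⊠ (Sw D B N ∘ (idm D ⊠ q))) ∘ Sw D A Z)
  = (idm B ⊠ Sw D A N) ∘ (Sw D B (A ⊗ N) ∘ (idm D ⊠ (Sw A B N ∘ (idm A ⊠ q)))).
Proof. by rewrite !tcr -!compA -r2a r3a. Qed.
Lemma r3c A B D N Z (q : Z ~> B ⊗ N) W (k : W ~> _) :
  Sw A B (D ⊗ N) ∘ ((idm A ⊠ (Sw D B N ∘ (idm D ⊠ q))) ∘ (Sw D A Z ∘ k))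
  = (idm B ⊠ Sw D A N) ∘ (Sw D B (A ⊗ N) ∘ ((idm D ⊠ (Sw A B N ∘ (idm A ⊠ q))) ∘ k)).
Proof. by have := r3b A D q; rewrite !compA => ->. Qed.
End Rules.

Ltac strict0 C := lazymatch goal with |- @eq (@hom _ ?A ?B) ?f ?g =>
  let F := rmor C f in let G := rmor C g in
  change (mval F = mval G); apply: strictP;
  cbn [mnf swp swa nfm nf];
  rewrite ?tens_id ?compose_idl ?compose_idr end.
Ltac strict C := strict0 C;
  rewrite -?compA -?tcr ?rM ?SwK ?r1;
  do ?[progress rewrite ?r2a ?r2b ?r2c ?r2d ?Sw_braid ?r3a ?r3b ?r3c -?compA -?tcr ?rM ?SwK ?r1 ?compose_idl ?compose_idr ?tens_id]; try reflexivity.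

Definition is_monoid (C : SymMonCat) (A : C) (m : A ⊗ A ~> A) (e : 𝟏 ~> A) : Prop :=
  [/\ m ∘ (m ⊠ idm A) = m ∘ (idm A ⊠ m) ∘ assoc A A A,
      m ∘ (e ⊠ idm A) = lunit A
    & m ∘ (idm A ⊠ e) = runit A].

Definition is_comonoid (C : SymMonCat) (P : C) (d : P ~> P ⊗ P) (e : P ~> 𝟏) : Prop :=
  [/\ assoc P P P ∘ (d ⊠ idm P) ∘ d = (idm P ⊠ d) ∘ d,
      lunit P ∘ (e ⊠ idm P) ∘ d = idm P
    & runit P ∘ (idm P ⊠ e) ∘ d = idm P].

Record Mon (C : SymMonCat) := {
  mon_ob :> C;
  mul : mon_ob ⊗ mon_ob ~> mon_ob;
  one : 𝟏 ~> mon_ob;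
  mon_laws : is_monoid mul one
}.
Arguments mul {C} _.
Arguments one {C} _.

Record Comon (C : SymMonCat) := {
  comon_ob :> C;
  comul : comon_ob ~> comon_ob ⊗ comon_ob;
  counit : comon_ob ~> 𝟏;
  comon_laws : is_comonoid comul counit
}.
Arguments comul {C} _.
Arguments counit {C} _.

Definition is_mon_hom (C : SymMonCat) (A B : Mon C) (f : A ~> B) : Prop :=
  f ∘ mul A = mul B ∘ (f ⊠ f) /\ f ∘ one A = one B.

Definition is_comon_hom (C : SymMonCat) (P Q : Comon C) (f : P ~> Q) : Prop :=
  comul Q ∘ f = (f ⊠ f) ∘ comul P /\ counit Q ∘ f = counit P.

Record MonHom (C : SymMonCat) (A B : Mon C) := {
  mon_hom :> A ~> B;
  mon_homP : is_mon_hom mon_hom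
}.

Record ComonHom (C : SymMonCat) (P Q : Comon C) := {
  comon_hom :> P ~> Q;
  comon_homP : is_comon_hom comon_hom
}.

Record Bimon (C : SymMonCat) := {
  bim_ob : C;
  bim_mul : bim_ob ⊗ bim_ob ~> bim_ob;
  bim_one : 𝟏 ~> bim_ob;
  bim_comul : bim_ob ~> bim_ob ⊗ bim_ob;
  bim_counit : bim_ob ~> 𝟏;
  bim_monoid : is_monoid bim_mul bim_one;
  bim_comonoid : is_comonoid bim_comul bim_counit;
  bim_comul_mul : bim_comul ∘ bim_mul
    = (bim_mul ⊠ bim_mul) ∘ swap4 bim_ob bim_ob bim_ob bim_ob ∘ (bim_comul ⊠ bim_comul);
  bim_comul_one : bim_comul ∘ bim_one = (bim_one ⊠ bim_one) ∘ lunit_inv 𝟏;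
  bim_counit_mul : bim_counit ∘ bim_mul = lunit 𝟏 ∘ (bim_counit ⊠ bim_counit);
  bim_counit_one : bim_counit ∘ bim_one = idm 𝟏
}.

Definition bim_mon (C : SymMonCat) (B : Bimon C) : Mon C := {|
  mon_ob := bim_ob B; mul := bim_mul B; one := bim_one B; mon_laws := bim_monoid B |}.
Definition bim_comon (C : SymMonCat) (B : Bimon C) : Comon C := {|
  comon_ob := bim_ob B; comul := bim_comul B; counit := bim_counit B;
  comon_laws := bim_comonoid B |}.
Coercion bim_mon : Bimon >-> Mon.
Coercion bim_comon : Bimon >-> Comon.

Record BimonHom (C : SymMonCat) (A B : Bimon C) := {
  bim_hom :> bim_mon A ~> bim_mon B;
  bim_hom_mon : is_mon_hom (A := A) (B := B) bim_hom;
  bim_hom_comon : is_comon_hom (P := A) (Q := B) bim_hom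
}.

Definition is_hopf (C : SymMonCat) (H : Bimon C) : Prop :=
  exists S : bim_ob H ~> bim_ob H,
    mul H ∘ (S ⊠ idm _) ∘ comul H = one H ∘ counit H /\
    mul H ∘ (idm _ ⊠ S) ∘ comul H = one H ∘ counit H.

(* The antipode is unique and preserved by every bimonoid homomorphism, so
   being a Hopf monoid is a property and Hopf(C) is a full subcategory. *)
Record Hopf (C : SymMonCat) := {
  hopf_bim :> Bimon C;
  hopf_antipode : is_hopf hopf_bim
}.

Section Hom_categories.
Variable C : SymMonCat.

Lemma mon_hom_eq (A B : Mon C) (f g : MonHom A B) : f = g :> (A ~> B) -> f = g.
Proof.
case: f g => [f pf] [g pg] /= e; case: g / e pg => pg.
by rewrite (proof_irrelevance _ pf pg).
Qed.
Lemma comon_hom_eq (A B : Comon C) (f g : ComonHom A B) : f = g :> (A ~> B) -> f = g.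
Proof.
case: f g => [f pf] [g pg] /= e; case: g / e pg => pg.
by rewrite (proof_irrelevance _ pf pg).
Qed.
Lemma bim_hom_eq (A B : Bimon C) (f g : BimonHom A B) :
  f = g :> (bim_ob A ~> bim_ob B) -> f = g.
Proof.
case: f g => [f pf qf] [g pg qg] /= e; case: g / e pg qg => pg qg.
by rewrite (proof_irrelevance _ pf pg) (proof_irrelevance _ qf qg).
Qed.

Lemma is_mon_hom_id (A : Mon C) : is_mon_hom (A := A) (B := A) (idm A).
Proof. by split; rewrite ?tens_id ?compose_idl ?compose_idr. Qed.
Lemma is_mon_hom_comp (A B D : Mon C) (g : B ~> D) (f : A ~> B) :
  is_mon_hom g -> is_mon_hom f -> is_mon_hom (A := A) (B := D) (g ∘ f).
Proof.
move=> [g1 g2] [f1 f2]; split; last by rewrite -compA f2.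
by rewrite -compA f1 compA g1 tens_comp compA.
Qed.
Lemma is_comon_hom_id (A : Comon C) : is_comon_hom (P := A) (Q := A) (idm A).
Proof. by split; rewrite ?tens_id ?compose_idl ?compose_idr. Qed.
Lemma is_comon_hom_comp (A B D : Comon C) (g : B ~> D) (f : A ~> B) :
  is_comon_hom g -> is_comon_hom f -> is_comon_hom (P := A) (Q := D) (g ∘ f).
Proof.
move=> [g1 g2] [f1 f2]; split; last by rewrite compA g2.
by rewrite compA g1 -compA f1 compA tens_comp.
Qed.

Definition mon_hom_id (A : Mon C) : MonHom A A := Build_MonHom (is_mon_hom_id A).
Definition mon_hom_comp (A B D : Mon C) (g : MonHom B D) (f : MonHom A B) : MonHom A D :=
  Build_MonHom (is_mon_hom_comp (mon_homP g) (mon_homP f)).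
Definition comon_hom_id (A : Comon C) : ComonHom A A := Build_ComonHom (is_comon_hom_id A).
Definition comon_hom_comp (A B D : Comon C) (g : ComonHom B D) (f : ComonHom A B) :
    ComonHom A D :=
  Build_ComonHom (is_comon_hom_comp (comon_homP g) (comon_homP f)).
Definition bim_hom_id (A : Bimon C) : BimonHom A A :=
  Build_BimonHom (is_mon_hom_id A) (is_comon_hom_id A).
Definition bim_hom_comp (A B D : Bimon C) (g : BimonHom B D) (f : BimonHom A B) :
    BimonHom A D :=
  Build_BimonHom (is_mon_hom_comp (bim_hom_mon g) (bim_hom_mon f))
    (is_comon_hom_comp (bim_hom_comon g) (bim_hom_comon f)).

Definition MON : Category.
Proof.
refine {| ob := Mon C; hom := @MonHom C; idm := mon_hom_id; compose := mon_hom_comp |}.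
- by move=> *; apply: mon_hom_eq; apply: compose_idl.
- by move=> *; apply: mon_hom_eq; apply: compose_idr.
- by move=> *; apply: mon_hom_eq; apply: compose_assoc.
Defined.

Definition COMON : Category.
Proof.
refine {| ob := Comon C; hom := @ComonHom C; idm := comon_hom_id; compose := comon_hom_comp |}.
- by move=> *; apply: comon_hom_eq; apply: compose_idl.
- by move=> *; apply: comon_hom_eq; apply: compose_idr.
- by move=> *; apply: comon_hom_eq; apply: compose_assoc.
Defined.

Definition BIMON : Category.
Proof.
refine {| ob := Bimon C; hom := @BimonHom C; idm := bim_hom_id; compose := bim_hom_comp |}.
- by move=> *; apply: bim_hom_eq; apply: compose_idl.
- by move=> *; apply: bim_hom_eq; apply: compose_idr.
- by move=> *; apply: bim_hom_eq; apply: compose_assoc.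
Defined.

Definition HOPF : Category.
Proof.
refine {| ob := Hopf C; hom := fun H K => BimonHom H K;
  idm := fun H => bim_hom_id H; compose := fun H K L g f => bim_hom_comp g f |}.
- by move=> *; apply: (compose_idl (c := BIMON)).
- by move=> *; apply: (compose_idr (c := BIMON)).
- by move=> *; apply: (compose_assoc (c := BIMON)).
Defined.

Definition hopf_incl : Functor HOPF BIMON.
Proof.
refine {| fob := fun H : HOPF => hopf_bim H : BIMON; fmap := fun H K (f : BimonHom H K) => f |}.
- by [].
- by [].
Defined.

End Hom_categories.

Section Structure.
Variable C : SymMonCat.
Implicit Types X Y P Q : C.

Lemma swap4_natural (A B D E A' B' D' E' : C)
    (f : A ~> A') (g : B ~> B') (h : D ~> D') (k : E ~> E') :
  swap4 A' B' D' E' ∘ ((f ⊠ g) ⊠ (h ⊠ k)) = ((f ⊠ h) ⊠ (g ⊠ k)) ∘ swap4 A B D E.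
Proof.
have e U V W : assoc U V W ∘ (symm V U ⊠ idm W) ∘ assoc_inv V U W = Sw V U W.
  by move=> *; rewrite /Sw -lock.
rewrite /swap4 -!lock !e -compA assoc_natural -[LHS]compA [(_ ⊠ Sw _ _ _) ∘ _]compA -tens_comp.
rewrite compose_idl Sw_natural -{1}(compose_idr f) tens_comp !compA.
by rewrite assoc_inv_natural.
Qed.

Lemma is_comonoid_unit : is_comonoid (lunit_inv 𝟏) (idm (𝟏 : C)).
Proof.
have e : lunit 𝟏 ∘ lunit_inv 𝟏 = idm (𝟏 : C) by exact: lunit_invK.
split; rewrite ?tens_id ?compose_idr //; last by rewrite -lunit_runit.
congr (_ ∘ _); strict C.
Qed.

Definition unit_comon : Comon C := {| comon_laws := is_comonoid_unit |}.

Lemma is_comonoid_tens (P Q : Comon C) :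
  is_comonoid (swap4 P P Q Q ∘ (comul P ⊠ comul Q)) (lunit 𝟏 ∘ (counit P ⊠ counit Q)).
Proof.
case: (comon_laws P) (comon_laws Q) => p1 p2 p3 [q1 q2 q3].
have el X Y (f : P ~> X) (g : Q ~> Y) : (f ⊠ g) ⊠ idm (P ⊗ Q) = (f ⊠ g) ⊠ (idm P ⊠ idm Q).
  by rewrite tens_id.
have er X Y (f : P ~> X) (g : Q ~> Y) : idm (P ⊗ Q) ⊠ (f ⊠ g) = (idm P ⊠ idm Q) ⊠ (f ⊠ g).
  by rewrite tens_id.
split.
- have s3 : assoc _ _ _ ∘ (swap4 P P Q Q ⊠ idm _) ∘ swap4 (P ⊗ P) P (Q ⊗ Q) Q
      = (idm _ ⊠ swap4 P P Q Q) ∘ swap4 P (P ⊗ P) Q (Q ⊗ Q) ∘ (assoc P P P ⊠ assoc Q Q Q).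
    by rewrite /swap4 -!lock; strict C.
  rewrite tcl tcr el er !compA.
  rewrite -[_ ∘ _ ∘ swap4 P P Q Q]compA -swap4_natural !compA s3.
  rewrite -[_ ∘ _ ∘ swap4 P P Q Q in RHS]compA -swap4_natural.
  by rewrite -!compA -!tens_comp !compA p1 q1.
- have s3 : lunit (P ⊗ Q) ∘ (lunit 𝟏 ⊠ idm _) ∘ swap4 𝟏 P 𝟏 Q = lunit P ⊠ lunit Q.
    by rewrite /swap4 -!lock; strict C.
  rewrite tcl el !compA -[_ ∘ _ ∘ swap4 P P Q Q]compA -swap4_natural !compA s3.
  by rewrite -compA -!tens_comp !compA p2 q2 tens_id.
- have s3 : runit (P ⊗ Q) ∘ (idm _ ⊠ lunit 𝟏) ∘ swap4 P 𝟏 Q 𝟏 = runit P ⊠ runit Q.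
    by rewrite /swap4 -!lock; strict C.
  rewrite tcr er !compA -[_ ∘ _ ∘ swap4 P P Q Q]compA -swap4_natural !compA s3.
  by rewrite -compA -!tens_comp !compA p3 q3 tens_id.
Qed.

Definition tens_comon (P Q : Comon C) : Comon C :=
  {| comon_laws := is_comonoid_tens P Q |}.

Lemma is_comon_hom_tens (P Q P' Q' : Comon C) (f : P ~> P') (g : Q ~> Q') :
  is_comon_hom f -> is_comon_hom g ->
  is_comon_hom (P := tens_comon P Q) (Q := tens_comon P' Q') (f ⊠ g).
Proof.
move=> [f1 f2] [g1 g2]; split; rewrite /= -compA -tens_comp; last by rewrite f2 g2.
by rewrite f1 g1 tens_comp compA swap4_natural !compA.
Qed.

Lemma is_comon_hom_assoc (P Q R : Comon C) :
  is_comon_hom (P := tens_comon (tens_comon P Q) R) (Q := tens_comon P (tens_comon Q R))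
    (assoc P Q R).
Proof.
split; rewrite /=.
- have s3 : (idm _ ⊠ swap4 Q Q R R) ∘ assoc (P ⊗ P) (Q ⊗ Q) (R ⊗ R) = idm _ ⊠ swap4 Q Q R R ∘ assoc _ _ _ by [].
  rewrite -{1}(compose_idl (comul P)) tens_comp -!compA -assoc_natural.
  rewrite -{2}(compose_idl (comul R)) tens_comp !compA.
  by congr (_ ∘ _); rewrite /swap4 -!lock; strict C.
- rewrite -{1}(compose_idl (counit P)) tens_comp -!compA -assoc_natural.
  rewrite -{2}(compose_idl (counit R)) tens_comp !compA.
  by congr (_ ∘ _); strict C.
Qed.

Lemma is_comon_hom_lunit (P : Comon C) :
  is_comon_hom (P := tens_comon unit_comon P) (Q := P) (lunit P).
Proof.
split; rewrite /= -lunit_natural //.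
rewrite (tens_split (lunit_inv 𝟏)) !compA; congr (_ ∘ _).
by rewrite /swap4 -!lock; strict C.
Qed.

Lemma is_comon_hom_runit (P : Comon C) :
  is_comon_hom (P := tens_comon P unit_comon) (Q := P) (runit P).
Proof.
split; rewrite /= -runit_natural ?lunit_runit //.
rewrite (tens_split' _ (lunit_inv 𝟏)) !compA; congr (_ ∘ _).
by rewrite /swap4 -!lock; strict C.
Qed.

Definition pair (X Y P Q : C) (f : X ⊗ P ~> 𝟏) (g : Y ⊗ Q ~> 𝟏) :
    (X ⊗ Y) ⊗ (P ⊗ Q) ~> 𝟏 :=
  locked (lunit 𝟏 ∘ (f ⊠ g) ∘ swap4 X Y P Q).

Lemma pairE (X Y P Q : C) (f : X ⊗ P ~> 𝟏) (g : Y ⊗ Q ~> 𝟏) :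
  pair f g = lunit 𝟏 ∘ (f ⊠ g) ∘ swap4 X Y P Q.
Proof. by rewrite /pair -lock. Qed.

Lemma pair_natural (X Y P Q X' Y' P' Q' : C) (f : X ⊗ P ~> 𝟏) (g : Y ⊗ Q ~> 𝟏)
    (x : X' ~> X) (y : Y' ~> Y) (p : P' ~> P) (q : Q' ~> Q) :
  pair f g ∘ ((x ⊠ y) ⊠ (p ⊠ q)) = pair (f ∘ (x ⊠ p)) (g ∘ (y ⊠ q)).
Proof. by rewrite !pairE -compA swap4_natural tens_comp !compA. Qed.

Lemma pair_assoc (X Y Z P Q R : C) (f : X ⊗ P ~> 𝟏) (g : Y ⊗ Q ~> 𝟏) (h : Z ⊗ R ~> 𝟏) :
  pair f (pair g h) ∘ (assoc X Y Z ⊠ assoc P Q R) = pair (pair f g) h.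
Proof.
rewrite !pairE.
have s1 : idm _ ⊠ swap4 Y Z Q R ∘ swap4 X (Y ⊗ Z) P (Q ⊗ R) ∘ (assoc X Y Z ⊠ assoc P Q R)
   = assoc _ _ _ ∘ (swap4 X Y P Q ⊠ idm _) ∘ swap4 (X ⊗ Y) Z (P ⊗ Q) R.
  by rewrite /swap4 -!lock; strict C.
have s2 : lunit 𝟏 ∘ (idm 𝟏 ⊠ lunit 𝟏) ∘ assoc 𝟏 𝟏 𝟏 = lunit 𝟏 ∘ (lunit 𝟏 ⊠ idm (𝟏 : C)).
  by strict C.
have -> : f ⊠ (lunit 𝟏 ∘ (g ⊠ h) ∘ swap4 Y Z Q R)
    = (idm 𝟏 ⊠ lunit 𝟏) ∘ (f ⊠ (g ⊠ h)) ∘ (idm (X ⊗ P) ⊠ swap4 Y Z Q R).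
  by rewrite -!tens_comp compose_idl compose_idr.
have -> : (lunit 𝟏 ∘ (f ⊠ g) ∘ swap4 X Y P Q) ⊠ h
    = (lunit 𝟏 ⊠ idm 𝟏) ∘ ((f ⊠ g) ⊠ h) ∘ (swap4 X Y P Q ⊠ idm (Z ⊗ R)).
  by rewrite -!tens_comp compose_idl compose_idr.
rewrite !compA -s2 -[_ ∘ _ ∘ ((f ⊠ g) ⊠ h)]compA assoc_natural -!compA.
do 3!congr (_ ∘ _); rewrite !compA; exact: s1.
Qed.

Lemma pair_unitl (Y Q : C) (g : Y ⊗ Q ~> 𝟏) :
  pair (lunit 𝟏) g = g ∘ (lunit Y ⊠ lunit Q).
Proof.
rewrite !pairE tens_split' compA lunit_natural.
have -> : lunit Y ⊠ lunit Q = lunit (Y ⊗ Q) ∘ (lunit 𝟏 ⊠ idm _) ∘ swap4 𝟏 Y 𝟏 Q.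
  by rewrite /swap4 -!lock; strict C.
by rewrite !compA.
Qed.

Lemma pair_unitr (Y Q : C) (g : Y ⊗ Q ~> 𝟏) :
  pair g (lunit 𝟏) = g ∘ (runit Y ⊠ runit Q).
Proof.
rewrite !pairE tens_split compA lunit_runit runit_natural -lunit_runit.
have -> : runit Y ⊠ runit Q = runit (Y ⊗ Q) ∘ (idm _ ⊠ lunit 𝟏) ∘ swap4 Y 𝟏 Q 𝟏.
  by rewrite /swap4 -!lock; strict C.
by rewrite !compA.
Qed.

Lemma pair_pair (X1 X2 Y1 Y2 P1 P2 Q1 Q2 : C) (f : X1 ⊗ P1 ~> 𝟏) (g : X2 ⊗ P2 ~> 𝟏)
    (h : Y1 ⊗ Q1 ~> 𝟏) (k : Y2 ⊗ Q2 ~> 𝟏) :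
  pair (pair f g) (pair h k) ∘ (swap4 X1 Y1 X2 Y2 ⊠ idm _)
  = pair (pair f h) (pair g k) ∘ (idm _ ⊠ swap4 P1 P2 Q1 Q2).
Proof.
have s2 : lunit 𝟏 ∘ (lunit 𝟏 ⊠ lunit 𝟏) = lunit 𝟏 ∘ (lunit 𝟏 ⊠ lunit 𝟏) ∘ swap4 𝟏 𝟏 𝟏 (𝟏 : C).
  by rewrite /swap4 -!lock; strict C.
have s5 : swap4 _ _ _ _ ∘ (swap4 X1 X2 P1 P2 ⊠ swap4 Y1 Y2 Q1 Q2)
    ∘ swap4 (X1 ⊗ X2) (Y1 ⊗ Y2) (P1 ⊗ P2) (Q1 ⊗ Q2) ∘ (swap4 X1 Y1 X2 Y2 ⊠ idm _)
  = (swap4 X1 Y1 P1 Q1 ⊠ swap4 X2 Y2 P2 Q2)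
    ∘ swap4 (X1 ⊗ Y1) (X2 ⊗ Y2) (P1 ⊗ Q1) (P2 ⊗ Q2) ∘ (idm _ ⊠ swap4 P1 P2 Q1 Q2).
  by rewrite /swap4 -!lock; strict C.
rewrite !pairE !tens_comp !compA {1}s2.
rewrite -[_ ∘ swap4 _ _ _ _ ∘ (_ ⊠ _ ⊠ _)]compA swap4_natural -!compA.
do 3!congr (_ ∘ _); rewrite !compA; exact: s5.
Qed.
End Structure.

Record PreRigid (C : SymMonCat) := {
  dual : C -> C;
  ev : forall A, dual A ⊗ A ~> 𝟏;
  curry : forall A B, (B ⊗ A ~> 𝟏) -> (B ~> dual A);
  curryK : forall A B (h : B ⊗ A ~> 𝟏), ev A ∘ (curry h ⊠ idm A) = h;
  uncurryK : forall A B (f : B ~> dual A), curry (ev A ∘ (f ⊠ idm A)) = f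
}.

Section Duals.
Variables (C : SymMonCat) (D : PreRigid C).
Implicit Types A B : C.

Definition dual_map A B (f : A ~> B) : dual D B ~> dual D A :=
  curry D (ev D B ∘ (idm (dual D B) ⊠ f)).

(* [swap4 A^* B^* A B] uses the symmetry [B^* ⊗ A ~> A ⊗ B^*], which is the
   inverse of [symm A B^*]. *)
Definition theta A B : dual D A ⊗ dual D B ~> dual D (A ⊗ B) :=
  curry D (lunit 𝟏 ∘ (ev D A ⊠ ev D B) ∘ swap4 (dual D A) (dual D B) A B).

Definition iota : 𝟏 ~> dual D 𝟏 := curry D (lunit 𝟏).

Definition alpha A : A ~> dual D (dual D A) := curry D (ev D A ∘ symm A (dual D A)).

Lemma alphaE A :
  ev D (dual D A) ∘ (alpha A ⊠ idm (dual D A)) ∘ symm (dual D A) A = ev D A.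
Proof. by rewrite curryK -compA symmK compose_idr. Qed.

Definition vee A B Q (rho : A ~> B ⊗ Q) : dual D Q ⊗ A ~> B :=
  runit B ∘ (idm B ⊠ ev D Q) ∘ assoc B (dual D Q) Q ∘ (symm (dual D Q) B ⊠ idm Q)
  ∘ assoc_inv (dual D Q) B Q ∘ (idm (dual D Q) ⊠ rho).

Definition uncurry A B (f : B ~> dual D A) : B ⊗ A ~> 𝟏 := ev D A ∘ (f ⊠ idm A).

Lemma uncurry_inj A B (f g : B ~> dual D A) : uncurry f = uncurry g -> f = g.
Proof. by move=> e; rewrite -(uncurryK f) -(uncurryK g); congr curry. Qed.
Lemma uncurry_comp A B B' (f : B ~> dual D A) (g : B' ~> B) :
  uncurry (f ∘ g) = uncurry f ∘ (g ⊠ idm A).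
Proof. by rewrite /uncurry tcl compA. Qed.
Lemma uncurry_dual_map A A' B (g : A ~> A') (f : B ~> dual D A') :
  uncurry (dual_map g ∘ f) = uncurry f ∘ (idm B ⊠ g).
Proof.
by rewrite uncurry_comp /uncurry curryK -!compA -!tens_comp !compose_idl !compose_idr.
Qed.
Lemma uncurry_dual_map1 A A' (g : A ~> A') :
  uncurry (dual_map g) = ev D A' ∘ (idm _ ⊠ g).
Proof. exact: curryK. Qed.
Lemma uncurry_theta A A' B B' (f : B ~> dual D A) (g : B' ~> dual D A') :
  uncurry (theta A A' ∘ (f ⊠ g)) = pair (uncurry f) (uncurry g).
Proof.
by rewrite uncurry_comp /uncurry curryK -pairE -tens_id pair_natural.
Qed.
Lemma uncurry_mul (P : Comon C) X Y (f : X ~> dual D P) (g : Y ~> dual D P) :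
  uncurry (dual_map (comul P) ∘ theta P P ∘ (f ⊠ g))
  = pair (uncurry f) (uncurry g) ∘ (idm _ ⊠ comul P).
Proof. by rewrite -compA uncurry_dual_map uncurry_theta. Qed.
Lemma uncurry_one (P : Comon C) :
  uncurry (dual_map (counit P) ∘ iota) = lunit 𝟏 ∘ (idm 𝟏 ⊠ counit P).
Proof. by rewrite uncurry_dual_map /uncurry curryK. Qed.

Lemma is_monoid_dual (P : Comon C) :
  is_monoid (dual_map (comul P) ∘ theta P P) (dual_map (counit P) ∘ iota).
Proof.
case: (comon_laws P) => p1 p2 p3.
have hd : uncurry (idm (dual D P)) = ev D P by rewrite /uncurry tens_id compose_idr.
set m := dual_map _ ∘ theta _ _.
have hm : uncurry m = pair (ev D P) (ev D P) ∘ (idm _ ⊠ comul P).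
  by have := uncurry_mul (idm (dual D P)) (idm (dual D P)); rewrite hd tens_id compose_idr.
split; apply: uncurry_inj.
- have -> : uncurry (m ∘ (m ⊠ idm _))
      = pair (pair (ev D P) (ev D P)) (ev D P) ∘ (idm _ ⊠ ((comul P ⊠ idm P) ∘ comul P)).
    rewrite uncurry_mul hd hm -{3}(compose_idr (ev D P)) -(tens_id (dual D P) P) -pair_natural.
    by rewrite tens_id -compA tcr compA.
  have -> : uncurry (m ∘ (idm _ ⊠ m) ∘ assoc _ _ _)
      = pair (ev D P) (pair (ev D P) (ev D P)) ∘ (assoc _ _ _ ⊠ ((idm P ⊠ comul P) ∘ comul P)).
    rewrite uncurry_comp uncurry_mul hd hm -{1}(compose_idr (ev D P)).
    rewrite -(tens_id (dual D P) P) -pair_natural -!compA -!tens_comp.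
    by rewrite tens_id !compose_idl !compose_idr.
  by rewrite -p1 -pair_assoc -compA -!tens_comp compose_idr !compA.
- rewrite uncurry_mul hd uncurry_one -{1}(compose_idr (ev D P)) -(tens_id (dual D P) P).
  rewrite -pair_natural pair_unitl -!compA -!tens_comp tens_id !compose_idr !compA p2.
  by rewrite /uncurry.
- rewrite uncurry_mul hd uncurry_one -{1}(compose_idr (ev D P)) -(tens_id (dual D P) P).
  rewrite -pair_natural pair_unitr -!compA -!tens_comp tens_id !compose_idr !compA p3.
  by rewrite /uncurry.
Qed.

Definition dual_mon (P : Comon C) : Mon C := {| mon_laws := is_monoid_dual P |}.

Lemma is_mon_hom_dual_map (P Q : Comon C) (g : P ~> Q) :
  is_comon_hom g -> is_mon_hom (A := dual_mon Q) (B := dual_mon P) (dual_map g).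
Proof.
move=> [g1 g2]; split; apply: uncurry_inj.
- rewrite uncurry_dual_map uncurry_mul.
  have e := uncurry_dual_map g (idm (dual D Q)); rewrite compose_idr in e.
  have h := uncurry_mul (idm (dual D Q)) (idm (dual D Q)); rewrite tens_id compose_idr in h.
  rewrite /= h !e -pair_natural !tens_id -!compA -!tcr.
  by rewrite -g1.
- by rewrite uncurry_dual_map !uncurry_one -compA -tcr g2.
Qed.

Definition dual_mon_hom (P Q : Comon C) (g : ComonHom P Q) :
    MonHom (dual_mon Q) (dual_mon P) :=
  Build_MonHom (is_mon_hom_dual_map (comon_homP g)).

Definition dual_functor : Functor (opposite (COMON C)) (MON C).
Proof.
refine {| fob := fun P : opposite (COMON C) => dual_mon P : MON C;
  fmap := fun P Q (g : ComonHom Q P) => dual_mon_hom g |}.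
- move=> P; apply: mon_hom_eq; apply: uncurry_inj.
  by rewrite /= uncurry_dual_map1.
- move=> P Q R g f; apply: mon_hom_eq; apply: uncurry_inj.
  by rewrite /= uncurry_dual_map !uncurry_dual_map1 tcr compA.
Defined.

End Duals.

(* A contravariant functor [A ↦ A°] from monoids to comonoids together with a
   natural bijection Mon(A, P^* ) ≅ Comon(P, A°), that is, a left adjoint of the
   dual functor from Comon^op to Mon. *)
Record FiniteDual (C : SymMonCat) (D : PreRigid C) := {
  fdual_functor : Functor (MON C) (opposite (COMON C));
  fdual_adj : Adjunction fdual_functor (dual_functor D)
}.

Section Finite_duals.
Variables (C : SymMonCat) (D : PreRigid C) (F : FiniteDual D).

Definition fdual (A : Mon C) : Comon C := fdual_functor F A.

Definition fdual_tr (A : Mon C) (P : Comon C) (f : MonHom A (dual_mon D P)) :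
    ComonHom P (fdual A) :=
  adj_inv (fdual_adj F) (f : (A : MON C) ~> dual_functor D P).

Definition eta (A : Mon C) : MonHom A (dual_mon D (fdual A)) :=
  adj (fdual_adj F) (idm (fdual_functor F A)).

Definition kappa (A : Mon C) : fdual A ~> dual D A :=
  curry D (ev D (fdual A) ∘ (eta A ⊠ idm (fdual A)) ∘ symm (fdual A) A).

Lemma adjE (A : Mon C) (P : Comon C) (g : ComonHom P (fdual A)) :
  adj (fdual_adj F) (X := A) (Y := P) g = dual_map D g ∘ eta A :> (A ~> dual D P).
Proof.
have := adj_natural (fdual_adj F) (X := A) (Y' := P) (idm _) g (idm (fdual_functor F A)).
rewrite fmap_id !compose_idr => ->; exact: erefl.
Qed.

Lemma uncurry_tr (A : Mon C) (P : Comon C) (f : MonHom A (dual_mon D P)) :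
  uncurry (eta A) ∘ (idm A ⊠ fdual_tr f) = uncurry f.
Proof. by rewrite -uncurry_dual_map -adjE adj_invK. Qed.

Lemma fdual_inj (A : Mon C) (P : Comon C) (g g' : P ~> fdual A) :
  is_comon_hom g -> is_comon_hom g' ->
  uncurry (eta A) ∘ (idm A ⊠ g) = uncurry (eta A) ∘ (idm A ⊠ g') -> g = g'.
Proof.
move=> pg pg' e.
suff h : adj (fdual_adj F) (X := A) (Y := P) (Build_ComonHom pg)
    = adj (fdual_adj F) (X := A) (Y := P) (Build_ComonHom pg').
  have := congr1 (fun z => adj_inv (fdual_adj F) z) h; rewrite !adjK => k.
  by rewrite -[g]/(comon_hom (Build_ComonHom pg)) k.
apply: mon_hom_eq.
rewrite (adjE (Build_ComonHom pg)) (adjE (Build_ComonHom pg')).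
by apply: uncurry_inj; rewrite !uncurry_dual_map.
Qed.

Lemma uncurry_mon_hom_mul (A : Mon C) (P : Comon C) (f : A ~> dual D P) :
  is_mon_hom (A := A) (B := dual_mon D P) f ->
  uncurry f ∘ (mul A ⊠ idm P) = pair (uncurry f) (uncurry f) ∘ (idm _ ⊠ comul P).
Proof. by case=> h _; rewrite -uncurry_comp h uncurry_mul. Qed.
Lemma uncurry_mon_hom_one (A : Mon C) (P : Comon C) (f : A ~> dual D P) :
  is_mon_hom (A := A) (B := dual_mon D P) f ->
  uncurry f ∘ (one A ⊠ idm P) = lunit 𝟏 ∘ (idm 𝟏 ⊠ counit P).
Proof. by case=> _ h; rewrite -uncurry_comp h uncurry_one. Qed.

Lemma is_mon_hom_theta (B : Bimon C) (P Q : Comon C) (f : B ~> dual D P) (g : B ~> dual D Q) :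
  is_mon_hom (A := B) (B := dual_mon D P) f -> is_mon_hom (A := B) (B := dual_mon D Q) g ->
  is_mon_hom (A := B) (B := dual_mon D (tens_comon P Q))
    (theta D P Q ∘ (f ⊠ g) ∘ comul B).
Proof.
move=> pf pg; have := uncurry_mon_hom_mul pf; have := uncurry_mon_hom_mul pg.
have := uncurry_mon_hom_one pf; have := uncurry_mon_hom_one pg.
move=> /= g1 f1 gm fm.
have h : uncurry (theta D P Q ∘ (f ⊠ g) ∘ comul B)
    = pair (uncurry f) (uncurry g) ∘ (comul B ⊠ (idm P ⊠ idm Q)).
  by rewrite uncurry_comp uncurry_theta tens_id.
split; apply: uncurry_inj.
- have -> : uncurry (mul (dual_mon D (tens_comon P Q))
      ∘ ((theta D P Q ∘ (f ⊠ g) ∘ comul B) ⊠ (theta D P Q ∘ (f ⊠ g) ∘ comul B)))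
      = pair (pair (uncurry f) (uncurry g)) (pair (uncurry f) (uncurry g))
        ∘ (idm _ ⊠ swap4 P P Q Q) ∘ ((comul B ⊠ comul B) ⊠ (comul P ⊠ comul Q)).
    rewrite [LHS](uncurry_mul (P := tens_comon P Q)) h -pair_natural /= -!compA.
    by rewrite -!tens_comp !tens_id !compose_idl !compose_idr.
  rewrite uncurry_comp h -pair_pair (tens_id P Q) -[LHS]compA -tcl bim_comul_mul.
  have -> : ((bim_mul B ⊠ bim_mul B) ∘ swap4 _ _ _ _ ∘ (bim_comul B ⊠ bim_comul B))
      ⊠ idm (tens_comon P Q) = ((bim_mul B ⊠ bim_mul B) ⊠ (idm P ⊠ idm Q))
      ∘ (swap4 _ _ _ _ ⊠ idm _) ∘ ((bim_comul B ⊠ bim_comul B) ⊠ idm (P ⊗ Q)).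
    by rewrite !tcl tens_id.
  rewrite !compA pair_natural fm gm -pair_natural -!compA; congr (_ ∘ _).
  by rewrite -!tens_comp !tens_id !compose_idl !compose_idr.
- rewrite [RHS](uncurry_one D (tens_comon P Q)) uncurry_comp h (tens_id P Q).
  rewrite -[LHS]compA -tcl bim_comul_one tcl -(tens_id P Q) compA pair_natural f1 g1.
  rewrite -pair_natural pair_unitl -!compA -!tens_comp /= ?tens_id ?compose_idl ?compose_idr.
  by rewrite lunit_invK.
Qed.

Section Finite_dual_bimonoid.
Variable B : Bimon C.

Definition fdual_mul_hom : MonHom B (dual_mon D (tens_comon (fdual B) (fdual B))) :=
  Build_MonHom (is_mon_hom_theta (mon_homP (eta B)) (mon_homP (eta B))).

Lemma is_mon_hom_iota : is_mon_hom (A := B) (B := dual_mon D (unit_comon C))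
  (iota D ∘ counit B).
Proof.
have h : uncurry (iota D ∘ counit B) = lunit 𝟏 ∘ (counit B ⊠ idm 𝟏).
  by rewrite uncurry_comp /uncurry curryK.
split; apply: uncurry_inj.
- rewrite [RHS](uncurry_mul (P := unit_comon C)) h uncurry_comp h -pair_natural pair_unitl.
  rewrite -[LHS]compA -tcl bim_counit_mul /= tens_id.
  by rewrite -!compA -!tens_comp compose_idl lunit_invK compose_idr.
- rewrite [RHS](uncurry_one D (unit_comon C)) uncurry_comp h.
  by rewrite -[LHS]compA -tcl bim_counit_one.
Qed.

Definition fdual_one_hom : MonHom B (dual_mon D (unit_comon C)) :=
  Build_MonHom is_mon_hom_iota.

Definition fdual_mul : ComonHom (tens_comon (fdual B) (fdual B)) (fdual B) :=
  fdual_tr fdual_mul_hom.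
Definition fdual_one : ComonHom (unit_comon C) (fdual B) := fdual_tr fdual_one_hom.

Let e : B ⊗ fdual B ~> 𝟏 := uncurry (eta B).
Lemma e_mul : e ∘ (idm (bim_ob B) ⊠ fdual_mul) = pair e e ∘ (comul B ⊠ idm _).
Proof. by apply: etrans (uncurry_tr fdual_mul_hom) _; rewrite uncurry_comp uncurry_theta. Qed.
Lemma e_one : e ∘ (idm (bim_ob B) ⊠ fdual_one) = lunit 𝟏 ∘ (counit B ⊠ idm _).
Proof. by apply: etrans (uncurry_tr fdual_one_hom) _; rewrite uncurry_comp /uncurry curryK. Qed.

Lemma is_monoid_fdual : is_monoid fdual_mul fdual_one.
Proof.
case: (comon_laws B) => /= p1 p2 p3.
have mm X Y (x : X ~> fdual B) (y : Y ~> fdual B) :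
    e ∘ (idm _ ⊠ (fdual_mul ∘ (x ⊠ y))) = 
    pair (e ∘ (idm _ ⊠ x)) (e ∘ (idm _ ⊠ y)) ∘ (comul B ⊠ idm _).
  rewrite tcr compA e_mul -pair_natural -!compA -!tens_comp tens_id.
  by rewrite !compose_idl !compose_idr.
have e1 : e = e ∘ (idm _ ⊠ idm _) by rewrite tens_id compose_idr.
have pm := comon_homP fdual_mul; have po := comon_homP fdual_one.
have pid := is_comon_hom_id (fdual B).
have inj (R : Comon C) := @fdual_inj B R; rewrite -/e in inj.
have em := e_mul; have eo := e_one.
set P := fdual B in pm po pid mm e1 em eo inj *.
clearbody e.
split.
- apply: (inj (tens_comon (tens_comon P P) P)).
  + exact: is_comon_hom_comp pm (is_comon_hom_tens pm pid).
  + exact: is_comon_hom_comp (is_comon_hom_comp pm (is_comon_hom_tens pid pm))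
      (is_comon_hom_assoc _ _ _).
  rewrite [LHS]mm tcr compA [X in _ = X ∘ _]mm -e1 em.
  rewrite {3 4}e1 -!pair_natural -pair_assoc !tens_id -!compA -!tens_comp.
  by rewrite ?tens_id !compose_idl ?compose_idr compA p1.
- apply: (inj (tens_comon (unit_comon C) P)).
  + exact: is_comon_hom_comp pm (is_comon_hom_tens po pid).
  + exact: is_comon_hom_lunit.
  rewrite [LHS]mm -e1 eo {1}e1 -pair_natural pair_unitl -!compA -!tens_comp tens_id.
  by rewrite !compose_idr compA p2.
- apply: (inj (tens_comon P (unit_comon C))).
  + exact: is_comon_hom_comp pm (is_comon_hom_tens pid po).
  + exact: is_comon_hom_runit.
  rewrite [LHS]mm -e1 eo {1}e1 -pair_natural pair_unitr -!compA -!tens_comp tens_id.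
  by rewrite !compose_idr compA p3.
Qed.

Definition fdual_bim : Bimon C := {|
  bim_monoid := is_monoid_fdual;
  bim_comonoid := comon_laws (fdual B);
  bim_comul_mul := etrans (proj1 (comon_homP fdual_mul)) (compA _ _ _);
  bim_comul_one := proj1 (comon_homP fdual_one);
  bim_counit_mul := proj2 (comon_homP fdual_mul);
  bim_counit_one := proj2 (comon_homP fdual_one)
|}.
End Finite_dual_bimonoid.
End Finite_duals.

(* A^{⊗(n+1)} is A ⊗ A^{⊗n}, so that A^{⊗1} is A ⊗ 𝟏 rather than A; the powers
   of measurings and comeasurings below follow the same bracketing. *)
Fixpoint tpow (C : SymMonCat) (A : C) (n : nat) : C :=
  if n is S m then A ⊗ tpow A m else 𝟏.

Record Magma (C : SymMonCat) (Omega : Type) (s t : Omega -> nat) := {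
  mag_ob :> C;
  mag_op : forall w : Omega, tpow mag_ob (s w) ~> tpow mag_ob (t w)
}.
Arguments mag_op {C Omega s t} _ _.

Definition meas_tens (C : SymMonCat) (P : Comon C) (A1 A2 B1 B2 : C)
    (psi1 : P ⊗ A1 ~> B1) (psi2 : P ⊗ A2 ~> B2) : P ⊗ (A1 ⊗ A2) ~> B1 ⊗ B2 :=
  (psi1 ⊠ psi2) ∘ swap4 P P A1 A2 ∘ (comul P ⊠ idm (A1 ⊗ A2)).

Fixpoint meas_pow (C : SymMonCat) (P : Comon C) (A B : C) (psi : P ⊗ A ~> B) (n : nat) :
    P ⊗ tpow A n ~> tpow B n :=
  match n with
  | 0 => counit P ∘ runit P
  | S m => meas_tens psi (meas_pow psi m)
  end.

Definition comeas_tens (C : SymMonCat) (Q : Mon C) (A1 A2 B1 B2 : C)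
    (rho1 : A1 ~> B1 ⊗ Q) (rho2 : A2 ~> B2 ⊗ Q) : A1 ⊗ A2 ~> (B1 ⊗ B2) ⊗ Q :=
  (idm (B1 ⊗ B2) ⊠ mul Q) ∘ swap4 B1 Q B2 Q ∘ (rho1 ⊠ rho2).

Fixpoint comeas_pow (C : SymMonCat) (Q : Mon C) (A B : C) (rho : A ~> B ⊗ Q) (n : nat) :
    tpow A n ~> tpow B n ⊗ Q :=
  match n with
  | 0 => lunit_inv Q ∘ one Q
  | S m => comeas_tens rho (comeas_pow rho m)
  end.

Section Actions.
Variables (C : SymMonCat) (Omega : Type) (s t : Omega -> nat).
Implicit Types A B : Magma C s t.

Definition is_measuring A B (P : Comon C) (psi : P ⊗ A ~> B) : Prop :=
  forall w, mag_op B w ∘ meas_pow psi (s w) = meas_pow psi (t w) ∘ (idm P ⊠ mag_op A w).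

Definition is_comeasuring A B (Q : Mon C) (rho : A ~> B ⊗ Q) : Prop :=
  forall w, comeas_pow rho (t w) ∘ mag_op A w = (mag_op B w ⊠ idm Q) ∘ comeas_pow rho (s w).

Definition is_module (X : C) (M : Mon C) (psi : M ⊗ X ~> X) : Prop :=
  psi ∘ (mul M ⊠ idm X) = psi ∘ (idm M ⊠ psi) ∘ assoc M M X /\
  psi ∘ (one M ⊠ idm X) = lunit X.

Definition is_comodule (X : C) (U : Comon C) (rho : X ~> X ⊗ U) : Prop :=
  assoc X U U ∘ (rho ⊠ idm U) ∘ rho = (idm X ⊠ comul U) ∘ rho /\
  runit X ∘ (idm X ⊠ counit U) ∘ rho = idm X.

Definition is_action A (P : Bimon C) (psi : P ⊗ A ~> A) : Prop :=
  is_measuring (P := P) psi /\ is_module (M := P) psi.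

Definition is_coaction A (P : Bimon C) (rho : A ~> A ⊗ P) : Prop :=
  is_comeasuring (Q := P) rho /\ is_comodule (U := P) rho.

Definition tensor_epi (X Y Q : C) (rho : X ~> Y ⊗ Q) : Prop :=
  forall (R : C) (f g : Q ~> R), (idm Y ⊠ f) ∘ rho = (idm Y ⊠ g) ∘ rho -> f = g.

Definition tensor_mono (P X Y : C) (psi : P ⊗ X ~> Y) : Prop :=
  forall (R : C) (f g : R ~> P), psi ∘ (f ⊠ idm X) = psi ∘ (g ⊠ idm X) -> f = g.

Section Universal_comeasuring.
Variables (A : Magma C s t) (U : C) (rhoU : A ~> A ⊗ U).

Definition comeasuring_under (Q : Mon C) (rho : A ~> A ⊗ Q) : Prop :=
  is_comeasuring rho /\ exists tau : U ~> Q, (idm A ⊠ tau) ∘ rhoU = rho.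

(* The universal objects are initial (terminal) in categories whose objects are
   the pairs satisfying the preceding predicate; the property is unfolded. *)
Definition is_universal_comeasuring (Q : Mon C) (rho : A ~> A ⊗ Q) : Prop :=
  comeasuring_under rho /\
  forall (Q' : Mon C) (rho' : A ~> A ⊗ Q'), comeasuring_under rho' ->
    exists! phi : MonHom Q Q', (idm A ⊠ phi) ∘ rho = rho'.
End Universal_comeasuring.

Section Universal_measuring.
Variables (A : Magma C s t) (V : C) (psiV : V ⊗ A ~> A).

Definition measuring_over (P : Comon C) (psi : P ⊗ A ~> A) : Prop :=
  is_measuring psi /\ exists tau : P ~> V, psi = psiV ∘ (tau ⊠ idm A).

Definition is_universal_measuring (P : Comon C) (psi : P ⊗ A ~> A) : Prop :=
  measuring_over psi /\
  forall (P' : Comon C) (psi' : P' ⊗ A ~> A), measuring_over psi' ->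
    exists! phi : ComonHom P' P, psi ∘ (phi ⊠ idm A) = psi'.
End Universal_measuring.

Section Universal_Hopf_coaction.
Variables (A : Magma C s t) (U : Comon C) (rhoU : A ~> A ⊗ U).

Definition hopf_coaction_under (H : Hopf C) (rho : A ~> A ⊗ H) : Prop :=
  is_coaction rho /\ exists tau : ComonHom U H, (idm A ⊠ tau) ∘ rhoU = rho.

Definition is_universal_hopf_coaction (H : Hopf C) (rho : A ~> A ⊗ H) : Prop :=
  hopf_coaction_under rho /\
  forall (H' : Hopf C) (rho' : A ~> A ⊗ H'), hopf_coaction_under rho' ->
    exists! phi : BimonHom H H', (idm A ⊠ phi) ∘ rho = rho'.
End Universal_Hopf_coaction.

Section Universal_Hopf_action.
Variables (A : Magma C s t) (V : Mon C) (psiV : V ⊗ A ~> A).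

Definition hopf_action_over (H : Hopf C) (psi : H ⊗ A ~> A) : Prop :=
  is_action psi /\ exists tau : MonHom H V, psi = psiV ∘ (tau ⊠ idm A).

Definition is_universal_hopf_action (H : Hopf C) (psi : H ⊗ A ~> A) : Prop :=
  hopf_action_over psi /\
  forall (H' : Hopf C) (psi' : H' ⊗ A ~> A), hopf_action_over psi' ->
    exists! phi : BimonHom H' H, psi ∘ (phi ⊠ idm A) = psi'.
End Universal_Hopf_action.

End Actions.

(* Main.v *)
From mathcomp Require Import ssreflect ssrfun ssrbool.
Require Import Defs.

Set Implicit Arguments.
Unset Strict Implicit.
Unset Printing Implicit Defensive.

(** The idea is to show that the finite dual [H°] of the universal coacting
    Hopf monoid [H], acting on [A] through the evaluation [H ⊗ H° ~> 𝟏], is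
    itself a universal acting Hopf monoid ([fdual_action_universal]).  Two
    terminal objects are isomorphic by the unique comparison morphism, and that
    morphism is [β].

    All (co)actions are handled through pairings.  A pairing [e : P ⊗ Q ~> 𝟏]
    turns [rho : X ~> Y ⊗ Q] into [contract e rho : P ⊗ X ~> Y], which on
    elements is [p ⊗ x ↦ x_(0) e(p, x_(1))].  If [e] is multiplicative in [Q],
    comeasurings become measurings, and if it is multiplicative in [P],
    comodules become modules.  For [Q = P^*] the operation [contract] is
    injective: composed with the monomorphism
    [Y ⊗ P^* → Y^** ⊗ P^* → (Y^* ⊗ P)^*] given by [α] and [θ], a morphism into
    [Y ⊗ P^*] is determined by its contraction ([contract_dual_inj]).

    Existence of the comparison.  The universal comeasuring monoid [B] carries
    a bimonoid structure which makes its comeasuring a coaction.  Let a Hopf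
    monoid [L] act on [A] over [rho_U^∨].  Transposing the map [L ~> U^*] gives
    a comeasuring [A ~> A ⊗ L^*] under [rho_U], hence a monoid homomorphism
    [B ~> L^*], that is, a pairing [L ⊗ B ~> 𝟏] multiplicative in [B].  It is
    also multiplicative in [L], because such pairings are determined by the
    measurings that they induce and [L] acts.  So there is a bimonoid
    homomorphism [B ~> L°], by which the Hopf monoid [L°] coacts on [A] under
    [rho_U].  Universality of [H] gives [H ~> L°], and transposing the pairing
    [L ⊗ H ~> 𝟏] gives [L ~> H°].

    Uniqueness.  A bimonoid homomorphism [L ~> H°] has a transpose
    [H ~> L°].  Along the monoid homomorphism [B ~> H], the pairing
    [L ⊗ H ~> 𝟏] restricts to a pairing [L ⊗ B ~> 𝟏], which the action of [L]
    determines.  As [ϰ_L] is a monomorphism, this determines the composite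
    [B ~> H ~> L°], hence the coaction of [L°] on [A] that [H ~> L°] induces,
    hence [H ~> L°] itself by the universality of [H]. *)

(** * Contraction along a pairing *)

Section Contraction.
Variable C : SymMonCat.
Implicit Types P Q X Y Z : C.

Lemma swap4K (A B X Y : C) : swap4 A X B Y ∘ swap4 A B X Y = idm _.
Proof. by rewrite /swap4 -!lock; strict C. Qed.

(** For [e = ev] this is [rho^∨]; see [vee_contract].  The body is locked so that
    rewriting with associativity does not unfold it. *)
Definition contract P Q X Y (e : P ⊗ Q ~> 𝟏) (rho : X ~> Y ⊗ Q) : P ⊗ X ~> Y :=
  locked (runit Y ∘ (idm Y ⊠ e) ∘ Sw P Y Q ∘ (idm P ⊠ rho)).

Lemma contractE P Q X Y (e : P ⊗ Q ~> 𝟏) (rho : X ~> Y ⊗ Q) :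
  contract e rho = runit Y ∘ (idm Y ⊠ e) ∘ Sw P Y Q ∘ (idm P ⊠ rho).
Proof. by rewrite /contract -lock. Qed.

Lemma contract_precomp P Q X X' Y (e : P ⊗ Q ~> 𝟏) (rho : X ~> Y ⊗ Q) (f : X' ~> X) :
  contract e (rho ∘ f) = contract e rho ∘ (idm P ⊠ f).
Proof. by rewrite !contractE tcr compA. Qed.

Lemma contract_scalar P P' Q X Y (e : P ⊗ Q ~> 𝟏) (rho : X ~> Y ⊗ Q) (p : P' ~> P) :
  contract (e ∘ (p ⊠ idm Q)) rho = contract e rho ∘ (p ⊠ idm X).
Proof.
rewrite !contractE tcr compA -(compA _ (_ ⊠ (p ⊠ _))) -Sw_natural tens_id.
by rewrite -!compA -!tens_comp !compose_idl !compose_idr.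
Qed.

Lemma contract_postcomp P Q X Y Z (e : P ⊗ Q ~> 𝟏) (rho : X ~> Y ⊗ Q) (g : Y ~> Z) :
  contract e ((g ⊠ idm Q) ∘ rho) = g ∘ contract e rho.
Proof.
rewrite !contractE tcr compA -(compA _ (Sw _ _ _)) Sw_natural tens_id compA.
by rewrite -(compA _ (_ ⊠ e)) -tens_split' tens_split !compA runit_natural.
Qed.

Lemma contract_coef P Q Q' X Y (e : P ⊗ Q' ~> 𝟏) (rho : X ~> Y ⊗ Q) (q : Q ~> Q') :
  contract e ((idm Y ⊠ q) ∘ rho) = contract (e ∘ (idm P ⊠ q)) rho.
Proof. by rewrite !contractE !tcr compA -(compA _ (Sw _ _ _)) Sw_natural !compA. Qed.

Lemma contract_unit X : contract (lunit 𝟏) (runit_inv X) = lunit X.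
Proof. by rewrite !contractE /Sw -lock; strict C. Qed.

(** The reason why contraction turns the product of comeasurings into the
    product of measurings. *)
Lemma contract_tens P1 P2 Q1 Q2 X1 X2 Y1 Y2 (e1 : P1 ⊗ Q1 ~> 𝟏) (e2 : P2 ⊗ Q2 ~> 𝟏)
    (r1 : X1 ~> Y1 ⊗ Q1) (r2 : X2 ~> Y2 ⊗ Q2) :
  contract (pair e1 e2) (swap4 Y1 Q1 Y2 Q2 ∘ (r1 ⊠ r2))
  = (contract e1 r1 ⊠ contract e2 r2) ∘ swap4 P1 P2 X1 X2.
Proof.
rewrite !contractE !tens_comp -[RHS]compA -swap4_natural tens_id pairE !compA.
have h2 : (idm Y1 ⊠ e1) ⊠ (idm Y2 ⊠ e2)
    = swap4 Y1 Y2 𝟏 𝟏 ∘ (idm _ ⊠ (e1 ⊠ e2)) ∘ swap4 Y1 (P1 ⊗ Q1) Y2 (P2 ⊗ Q2).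
  by rewrite -tens_id swap4_natural -compA swap4K compose_idr.
have h : runit (Y1 ⊗ Y2) ∘ (idm _ ⊠ lunit 𝟏)
    = (runit Y1 ⊠ runit Y2) ∘ swap4 Y1 Y2 𝟏 𝟏 by rewrite /swap4 -!lock; strict C.
rewrite h2 !tcr !compA h; congr (_ ∘ _); rewrite -!compA; do 3!congr (_ ∘ _).
by rewrite /Sw /swap4 -!lock; strict C.
Qed.

(** Contracting an iterated coaction iterates the contracted action:
    [(p ⊗ q)·x = x_(0) e2(p, x_(1)) e1(q, x_(2)) = p·(q·x)].  By naturality the
    two maps [r1], [r2] can be split off, which leaves an identity between
    structural morphisms and the two pairings. *)
Lemma contract_comp P1 P2 Q1 Q2 X Y Z (e1 : P1 ⊗ Q1 ~> 𝟏) (e2 : P2 ⊗ Q2 ~> 𝟏)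
    (r1 : X ~> Y ⊗ Q1) (r2 : Y ~> Z ⊗ Q2) :
  contract (pair e2 e1) (assoc Z Q2 Q1 ∘ (r2 ⊠ idm Q1) ∘ r1)
  = contract e2 r2 ∘ (idm P2 ⊠ contract e1 r1) ∘ assoc P2 P1 X.
Proof.
have h1 X' Y' Q (r : X' ~> Y' ⊗ Q) P (e : P ⊗ Q ~> 𝟏) :
    contract e r = contract e (idm _) ∘ (idm _ ⊠ r).
  by rewrite -contract_precomp compose_idl.
rewrite (h1 _ _ _ r1) (h1 _ _ _ r2) (h1 _ _ _ (_ ∘ r1)) !tcr !compA.
rewrite -[_ ∘ (idm P2 ⊠ r2) ∘ _]compA -tcr -contract_postcomp (h1 _ _ _ (_ ∘ idm _)).
rewrite compose_idr !tcr !compA -!(compA _ _ (assoc P2 P1 X)) -!assoc_nat3 !compA.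
rewrite -!(compA _ _ (assoc P2 P1 _)) -assoc_nat3 !compA.
congr (_ ∘ _ ∘ _) => {h1 r1 r2}.
(* [S N] rebrackets and moves [P2] past [Z]; its naturality in [N] lets [e1] act
   after [e2]. *)
set S := fun N => (idm Z ⊠ assoc_inv P2 Q2 N) ∘ Sw P2 Z (Q2 ⊗ N) ∘ (idm P2 ⊠ assoc Z Q2 N).
have nS N N' (f : N ~> N') : S N' ∘ (idm _ ⊠ (idm _ ⊠ f)) = (idm _ ⊠ (idm _ ⊠ f)) ∘ S N.
  rewrite /S -[LHS]compA -tcr assoc_nat3 tcr !compA -[_ ∘ Sw _ _ _ ∘ _]compA Sw_natural.
  rewrite !compA -!tcr; do 2!congr (_ ∘ _); congr (_ ⊠ _).
  by rewrite assoc_inv_natural tens_id.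
have e2S : contract e2 (idm _) ∘ (idm P2 ⊠ runit (Z ⊗ Q2))
    = runit Z ∘ (idm Z ⊠ (lunit 𝟏 ∘ (e2 ⊠ idm 𝟏))) ∘ S 𝟏.
  rewrite lunit_runit runit_natural.
  rewrite !contractE /S tens_id compose_idr tcr -!compA; do 2!congr (_ ∘ _).
  by rewrite /Sw -!lock; strict C.
rewrite [contract e1 _]contractE tens_id compose_idr !tcr !compA e2S.
rewrite -[_ ∘ S 𝟏 ∘ _]compA nS !compA contractE pairE.
rewrite (tens_split e2) !tcr -!compA; do 4!congr (_ ∘ _).
by rewrite /S /Sw /swap4 -!lock; strict C.
Qed.
End Contraction.

Section Pairing_symmetries.
Variable C : SymMonCat.
Implicit Types P Q X Y Z : C.

Lemma contract_lunit_inv P Q X (e : P ⊗ Q ~> 𝟏) (q : X ~> Q) :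
  contract e (lunit_inv Q ∘ q) = e ∘ (idm P ⊠ q).
Proof.
rewrite contract_precomp; congr (_ ∘ _).
have h : Sw P 𝟏 Q ∘ (idm P ⊠ lunit_inv Q) = lunit_inv (P ⊗ Q).
  by rewrite /Sw -lock; strict C.
rewrite contractE -compA h -lunit_runit lunit_natural -compA lunit_invK.
by rewrite compose_idr.
Qed.

Lemma pair_symm X Y P Q (f : X ⊗ P ~> 𝟏) (g : Y ⊗ Q ~> 𝟏) :
  pair (f ∘ symm P X) (g ∘ symm Q Y) = pair f g ∘ symm (P ⊗ Q) (X ⊗ Y).
Proof.
rewrite !pairE tens_comp -!compA; do 2!congr (_ ∘ _).
by rewrite /swap4 -!lock; strict C.
Qed.

Lemma pair_swap X Y P Q (f : X ⊗ P ~> 𝟏) (g : Y ⊗ Q ~> 𝟏) :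
  pair f g ∘ (symm Y X ⊠ symm Q P) = pair g f.
Proof.
have h : lunit 𝟏 = lunit 𝟏 ∘ symm (𝟏 : C) 𝟏 by strict C.
rewrite [RHS]pairE {1}h -(compA _ (symm _ _)) symm_natural pairE -!compA; do 2!congr (_ ∘ _).
by rewrite /swap4 -!lock; strict C.
Qed.
End Pairing_symmetries.

Section Dual_contraction.
Variables (C : SymMonCat) (D : PreRigid C).

Lemma vee_contract (X Y Q : C) (rho : X ~> Y ⊗ Q) : vee D rho = contract (ev D Q) rho.
Proof. by rewrite contractE /vee /Sw -lock -!compA. Qed.

Lemma vee_scalar (P X Y Q : C) (rho : X ~> Y ⊗ Q) (f : P ~> dual D Q) :
  vee D rho ∘ (f ⊠ idm X) = contract (uncurry f) rho.
Proof. by rewrite vee_contract -contract_scalar. Qed.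

(** A morphism [r] into [Y ⊗ P^*] is composed with the monomorphisms
    [α_Y ⊗ id] and [θ]; the uncurried composite [X ⊗ (Y^* ⊗ P) ~> 𝟏] is
    [ev_Y] applied to the contraction of [r], so the contraction determines [r]. *)
Lemma contract_dual_inj (P X Y : C) :
  mono (theta D (dual D Y) P) -> mono (alpha D Y ⊠ idm (dual D P)) ->
  forall r r' : X ~> Y ⊗ dual D P,
  contract (ev D P ∘ symm P (dual D P)) r = contract (ev D P ∘ symm P (dual D P)) r' -> r = r'.
Proof.
move=> tm am r r' e; apply: am; apply: tm; apply: uncurry_inj.
rewrite !compA !(uncurry_comp _ r) !(uncurry_comp _ r') uncurry_theta.
have -> : uncurry (alpha D Y) = ev D Y ∘ symm _ _ by rewrite /uncurry curryK.
have -> : uncurry (idm (dual D P)) = ev D P by rewrite /uncurry tens_id compose_idr.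
have h (q : X ~> Y ⊗ dual D P) :
    pair (ev D Y ∘ symm Y (dual D Y)) (ev D P) ∘ (q ⊠ idm (dual D Y ⊗ P))
    = ev D Y ∘ (idm _ ⊠ contract (ev D P ∘ symm P (dual D P)) q) ∘ assoc _ _ _ ∘ symm _ _.
  rewrite -[in RHS](compose_idl q) contract_precomp tcr.
  have -> : q ⊠ idm (dual D Y ⊗ P) = symm _ _ ∘ (idm _ ⊠ q) ∘ symm _ _.
    by rewrite symm_natural -compA symmK compose_idr.
  rewrite -!compA (compA (idm _ ⊠ (idm _ ⊠ q))) -assoc_nat3 !compA; do 2!congr (_ ∘ _).
  rewrite contractE tens_id compose_idr !tcr !compA.
  have -> : ev D Y ∘ (idm _ ⊠ runit Y) = runit 𝟏 ∘ (ev D Y ⊠ idm 𝟏) ∘ assoc_inv _ _ _.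
    by rewrite runit_natural -runit_tens !compA asK'.
  rewrite -[_ ∘ assoc_inv _ _ _ ∘ _]compA assoc_inv_natural tens_id !compA.
  rewrite -[_ ∘ (ev D Y ⊠ _) ∘ _]compA -tens_split pairE -lunit_runit.
  rewrite -{1}(compose_idr (ev D P)) tens_comp -!compA; do 2!congr (_ ∘ _).
  by rewrite /Sw /swap4 -!lock; strict C.
by rewrite !h e.
Qed.
End Dual_contraction.

(** * Multiplicative pairings, measurings and comeasurings *)

Section Pairings.
Variable C : SymMonCat.

(** [left_mult e] says that [e(x y, p) = e(x, p_(1)) e(y, p_(2))] and
    [e(1, p) = ε(p)]; equivalently the transpose [M ~> P^*] is a monoid
    homomorphism ([mon_hom_left_mult]).  [right_mult] is the mirror image. *)
Definition left_mult (M : Mon C) (P : Comon C) (e : M ⊗ P ~> 𝟏) : Prop :=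
  e ∘ (mul M ⊠ idm P) = pair e e ∘ (idm (M ⊗ M) ⊠ comul P) /\
  e ∘ (one M ⊠ idm P) = lunit 𝟏 ∘ (idm 𝟏 ⊠ counit P).

Definition right_mult (P : Comon C) (M : Mon C) (e : P ⊗ M ~> 𝟏) : Prop :=
  e ∘ (idm P ⊠ mul M) = pair e e ∘ (comul P ⊠ idm (M ⊗ M)) /\
  e ∘ (idm P ⊠ one M) = lunit 𝟏 ∘ (counit P ⊠ idm 𝟏).

Lemma lunit_symm : lunit 𝟏 ∘ symm 𝟏 𝟏 = lunit (𝟏 : C).
Proof. by strict C. Qed.

Lemma left_mult_symm (M : Mon C) (P : Comon C) (e : M ⊗ P ~> 𝟏) :
  left_mult e -> right_mult (e ∘ symm P M).
Proof.
move=> [h1 h2]; split.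
- by rewrite -compA symm_natural compA h1 pair_symm -[RHS]compA symm_natural compA.
- by rewrite -compA symm_natural compA h2 -compA -symm_natural compA lunit_symm.
Qed.

Lemma right_mult_symm (P : Comon C) (M : Mon C) (e : P ⊗ M ~> 𝟏) :
  right_mult e -> left_mult (e ∘ symm M P).
Proof.
move=> [h1 h2]; split.
- by rewrite -compA symm_natural compA h1 pair_symm -[RHS]compA symm_natural compA.
- by rewrite -compA symm_natural compA h2 -compA -symm_natural compA lunit_symm.
Qed.

Lemma left_mult_precomp (M M' : Mon C) (P P' : Comon C) (e : M ⊗ P ~> 𝟏) (f : M' ~> M)
    (g : P' ~> P) :
  is_mon_hom f -> is_comon_hom g -> left_mult e -> left_mult (e ∘ (f ⊠ g)).
Proof.
move=> [f1 f2] [g1 g2] [h1 h2]; split; rewrite -compA -tens_comp compose_idr.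
- rewrite f1 -pair_natural -[g]compose_idl tens_comp compA h1.
  by rewrite -!compA -!tens_comp !compose_idl compose_idr -g1.
- rewrite f2 -(compose_idr (one M)) -[g]compose_idl tens_comp compA h2.
  by rewrite -compA -tens_comp compose_idl g2.
Qed.

Lemma right_mult_precomp (P P' : Comon C) (M M' : Mon C) (e : P ⊗ M ~> 𝟏) (g : P' ~> P)
    (f : M' ~> M) :
  is_comon_hom g -> is_mon_hom f -> right_mult e -> right_mult (e ∘ (g ⊠ f)).
Proof.
move=> hg hf /right_mult_symm he.
have := left_mult_symm (left_mult_precomp hf hg he).
by rewrite -(compA e) symm_natural -!compA symmK compose_idr.
Qed.

Lemma meas_tens_contract (P : Comon C) (Q : Mon C) (e : P ⊗ Q ~> 𝟏) (X1 X2 Y1 Y2 : C)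
    (r1 : X1 ~> Y1 ⊗ Q) (r2 : X2 ~> Y2 ⊗ Q) :
  right_mult e -> contract e (comeas_tens r1 r2) = meas_tens (contract e r1) (contract e r2).
Proof.
move=> [h1 _]; rewrite /comeas_tens /meas_tens -compA contract_coef h1.
by rewrite contract_scalar contract_tens.
Qed.

Lemma meas_pow_contract (P : Comon C) (Q : Mon C) (e : P ⊗ Q ~> 𝟏) (X Y : C)
    (r : X ~> Y ⊗ Q) n :
  right_mult e -> contract e (comeas_pow r n) = meas_pow (contract e r) n.
Proof.
move=> he; elim: n => [|n IHn] /=; last by rewrite -IHn -meas_tens_contract.
by rewrite contract_lunit_inv (proj2 he) lunit_runit runit_natural.
Qed.

Lemma module_contract (M : Mon C) (U : Comon C) (e : M ⊗ U ~> 𝟏) (X : C) (r : X ~> X ⊗ U) :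
  left_mult e -> is_comodule r -> is_module (contract e r).
Proof.
move=> [h1 h2] [r1 r2]; split; rewrite -contract_scalar.
- by rewrite h1 -contract_coef -r1 contract_comp.
- rewrite h2 -contract_coef -(compose_idl (_ ∘ r)) -runitK -compA (compA (runit X)) r2.
  by rewrite compose_idr contract_unit.
Qed.

Section Magmas.
Variables (Omega : Type) (s t : Omega -> nat).
Implicit Types A B : Magma C s t.

Lemma measuring_contract (P : Comon C) (Q : Mon C) (e : P ⊗ Q ~> 𝟏) A B (r : A ~> B ⊗ Q) :
  right_mult e -> is_comeasuring r -> is_measuring (contract e r).
Proof.
move=> he hr w; rewrite -!meas_pow_contract //.
by rewrite -contract_postcomp -contract_precomp hr.
Qed.
End Magmas.
End Pairings.

Section Dual_pairings.
Variables (C : SymMonCat) (D : PreRigid C).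

Lemma mon_hom_left_mult (M : Mon C) (P : Comon C) (f : M ~> dual D P) :
  is_mon_hom (A := M) (B := dual_mon D P) f <-> left_mult (uncurry f).
Proof.
split=> [h|[h1 h2]].
- split; [exact: uncurry_mon_hom_mul | exact: uncurry_mon_hom_one].
- split; apply: uncurry_inj.
  + by rewrite uncurry_comp h1 [RHS]uncurry_mul.
  + by rewrite uncurry_comp h2 [RHS]uncurry_one.
Qed.

Definition lcurry (M : Mon C) (P : Comon C) (e : M ⊗ P ~> 𝟏) (he : left_mult e) :
  MonHom M (dual_mon D P).
Proof.
apply: (@Build_MonHom _ _ (dual_mon D P) (curry D e)); apply/mon_hom_left_mult.
by rewrite /uncurry curryK.
Defined.

Lemma uncurry_lcurry (M : Mon C) (P : Comon C) (e : M ⊗ P ~> 𝟏) (he : left_mult e) :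
  uncurry (lcurry he) = e.
Proof. by rewrite /uncurry curryK. Qed.

(** The evaluation with its arguments exchanged, in the order which [contract]
    expects when [P] acts and [P^*] coacts. *)
Definition dual_pairing (P : C) : P ⊗ dual D P ~> 𝟏 := ev D P ∘ symm P (dual D P).

Lemma right_mult_dual_pairing (P : Comon C) : right_mult (M := dual_mon D P) (dual_pairing P).
Proof.
apply: left_mult_symm.
have := proj1 (mon_hom_left_mult (M := dual_mon D P) (P := P) (idm _)) (is_mon_hom_id _).
by rewrite /uncurry tens_id compose_idr.
Qed.

Hypothesis alpha_mono : forall M N : C, mono (alpha D M ⊠ idm N).
Hypothesis theta_mono : forall M N : C, mono (theta D M N).

(** The converse of [measuring_contract] for [Q = P^*]: the two sides of the
    comeasuring condition have equal contractions. *)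
Lemma comeasuring_contract (Omega : Type) (s t : Omega -> nat) (A B : Magma C s t)
   (P : Comon C) (r : A ~> B ⊗ dual_mon D P) :
  is_measuring (contract (dual_pairing P) r) -> is_comeasuring (Q := dual_mon D P) r.
Proof.
move=> h w; apply: (@contract_dual_inj _ D P _ _ (@theta_mono _ _) (@alpha_mono _ _)).
have m := @right_mult_dual_pairing P.
rewrite contract_precomp contract_postcomp.
have mp n : contract (dual_pairing P) (comeas_pow r n) = _ := meas_pow_contract r n m.
by move: (h w); rewrite -!mp => ->.
Qed.
End Dual_pairings.

(** * Tensor products of monoids and composites of comeasurings *)

Section Tensor_monoids.
Variable C : SymMonCat.

Lemma is_monoid_unit : is_monoid (lunit 𝟏) (idm (𝟏 : C)).
Proof.
split; rewrite ?tens_id ?compose_idr //; last exact: lunit_runit.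
by strict C.
Qed.
Definition unit_mon : Mon C := {| mon_laws := is_monoid_unit |}.

Lemma is_monoid_tens (P Q : Mon C) :
  is_monoid ((mul P ⊠ mul Q) ∘ swap4 P Q P Q) ((one P ⊠ one Q) ∘ lunit_inv 𝟏).
Proof.
case: (mon_laws P) (mon_laws Q) => p1 p2 p3 [q1 q2 q3].
split.
- have s3 : swap4 (P ⊗ P) (Q ⊗ Q) P Q ∘ (swap4 P Q P Q ⊠ idm _)
      = (assoc_inv P P P ⊠ assoc_inv Q Q Q) ∘ swap4 P Q (P ⊗ P) (Q ⊗ Q)
        ∘ (idm _ ⊠ swap4 P Q P Q) ∘ assoc _ _ _.
    by rewrite /swap4 -!lock; strict C.
  rewrite tcl tcr -!compA (compA (swap4 P Q P Q) ((_ ⊠ _) ⊠ _)) -{1}(tens_id P Q).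
  rewrite swap4_natural -!compA s3 !compA -!tens_comp p1 q1 !asK'.
  rewrite !tens_comp -!compA (compA (swap4 P Q P Q) (_ ⊠ (_ ⊠ _))) -(tens_id P Q).
  by rewrite swap4_natural -!compA.
- have s3 : swap4 𝟏 𝟏 P Q ∘ (lunit_inv 𝟏 ⊠ idm _) = (lunit_inv P ⊠ lunit_inv Q) ∘ lunit (P ⊗ Q).
    by rewrite /swap4 -!lock; strict C.
  rewrite tcl -compA (compA (swap4 P Q P Q)) -(tens_id P Q) swap4_natural -!compA tens_id s3.
  by rewrite !compA -!tens_comp p2 q2 !lunit_invK tens_id compose_idl.
- have s3 : swap4 P Q 𝟏 𝟏 ∘ (idm _ ⊠ lunit_inv 𝟏) = (runit_inv P ⊠ runit_inv Q) ∘ runit (P ⊗ Q).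
    by rewrite /swap4 -!lock; strict C.
  rewrite tcr -compA (compA (swap4 P Q P Q)) -(tens_id P Q) swap4_natural -!compA tens_id s3.
  by rewrite !compA -!tens_comp p3 q3 !runit_invK tens_id compose_idl.
Qed.
Definition tens_mon (P Q : Mon C) : Mon C := {| mon_laws := is_monoid_tens P Q |}.

Lemma is_mon_hom_tens (P Q P' Q' : Mon C) (f : P ~> P') (g : Q ~> Q') :
  is_mon_hom f -> is_mon_hom g ->
  is_mon_hom (A := tens_mon P Q) (B := tens_mon P' Q') (f ⊠ g).
Proof.
move=> [f1 f2] [g1 g2]; split; rewrite /= compA -tens_comp; last by rewrite f2 g2.
by rewrite f1 g1 tens_comp -!compA swap4_natural.
Qed.

Lemma is_mon_hom_assoc (P Q R : Mon C) :
  is_mon_hom (A := tens_mon (tens_mon P Q) R) (B := tens_mon P (tens_mon Q R))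
    (assoc P Q R).
Proof.
split; rewrite /=.
- rewrite -(compose_idr (mul R)) tens_comp !compA assoc_natural.
  rewrite -[X in _ = X ⊠ _ ∘ _ ∘ _](compose_idr (mul P)) tens_comp -!compA; congr (_ ∘ _).
    by rewrite compose_idr.
  by rewrite /swap4 -!lock; strict C.
- rewrite -(compose_idr (one R)) tens_comp !compA assoc_natural.
  rewrite -[X in _ = X ⊠ _ ∘ _](compose_idr (one P)) tens_comp -!compA; congr (_ ∘ _).
    by rewrite compose_idr.
  by strict C.
Qed.

Lemma is_mon_hom_lunit (P : Mon C) :
  is_mon_hom (A := tens_mon unit_mon P) (B := P) (lunit P).
Proof.
split; rewrite /=.
- rewrite (tens_split' (lunit 𝟏)) !compA lunit_natural -!compA; congr (_ ∘ _).
  by rewrite /swap4 -!lock; strict C.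
- by rewrite compA lunit_natural -compA lunit_invK compose_idr.
Qed.

Lemma is_mon_hom_runit (P : Mon C) :
  is_mon_hom (A := tens_mon P unit_mon) (B := P) (runit P).
Proof.
split; rewrite /=.
- rewrite (tens_split _ (lunit 𝟏)) !compA runit_natural -!compA; congr (_ ∘ _).
  by rewrite /swap4 -!lock; strict C.
- by rewrite compA runit_natural -lunit_runit -compA lunit_invK compose_idr.
Qed.
End Tensor_monoids.

Section Comeasurings.
Variable C : SymMonCat.

Lemma lunit_inv_natural (X Y : C) (f : X ~> Y) :
  lunit_inv Y ∘ f = (idm 𝟏 ⊠ f) ∘ lunit_inv X.
Proof.
rewrite -[LHS]compose_idr -(lunit_invK X) -(compA _ f) (compA f) -lunit_natural.
by rewrite !compA lunitK compose_idl.
Qed.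

Lemma runit_inv_natural (X Y : C) (f : X ~> Y) :
  runit_inv Y ∘ f = (f ⊠ idm 𝟏) ∘ runit_inv X.
Proof.
rewrite -[LHS]compose_idr -(runit_invK X) -(compA _ f) (compA f) -runit_natural.
by rewrite !compA runitK compose_idl.
Qed.

(** The composite of two comeasurings, a morphism with coefficients in the
    tensor product; [coact_comp r r = (id ⊗ Δ) r] is coassociativity of a
    coaction [r]. *)
Definition coact_comp (X Y Z Q1 Q2 : C) (r2 : Y ~> Z ⊗ Q2) (r1 : X ~> Y ⊗ Q1) :
    X ~> Z ⊗ (Q2 ⊗ Q1) :=
  assoc Z Q2 Q1 ∘ (r2 ⊠ idm Q1) ∘ r1.

Lemma comeas_tens_comp (Q1 Q2 : Mon C) (X X' Y Y' Z Z' : C) (r2 : Y ~> Z ⊗ Q2)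
    (r1 : X ~> Y ⊗ Q1) (r2' : Y' ~> Z' ⊗ Q2) (r1' : X' ~> Y' ⊗ Q1) :
  comeas_tens (Q := tens_mon Q2 Q1) (coact_comp r2 r1) (coact_comp r2' r1')
  = coact_comp (comeas_tens r2 r2') (comeas_tens r1 r1').
Proof.
rewrite /comeas_tens /coact_comp /=.
have e : ((idm _ ⊠ mul Q2) ∘ swap4 Z Q2 Z' Q2 ∘ (r2 ⊠ r2')) ⊠ idm Q1 ∘ (idm _ ⊠ mul Q1)
    = ((idm _ ⊠ mul Q2) ⊠ mul Q1) ∘ (swap4 Z Q2 Z' Q2 ⊠ idm _) ∘ ((r2 ⊠ r2') ⊠ (idm _ ⊠ idm _)).
  by rewrite tens_id -!tens_comp !compose_idl !compose_idr.
rewrite !compA -[_ ∘ _ ∘ (idm _ ⊠ mul Q1)]compA e !compA assoc_natural.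
rewrite -[_ ∘ ((r2 ⊠ r2') ⊠ _) ∘ _]compA -swap4_natural !tens_comp !compA.
do 2!congr (_ ∘ _); rewrite tcr -!compA; congr (_ ∘ _).
by rewrite /swap4 -!lock; strict C.
Qed.

Lemma comeas_pow_comp (Q1 Q2 : Mon C) (X Y Z : C) (r2 : Y ~> Z ⊗ Q2) (r1 : X ~> Y ⊗ Q1) n :
  comeas_pow (Q := tens_mon Q2 Q1) (coact_comp r2 r1) n
  = coact_comp (comeas_pow r2 n) (comeas_pow r1 n).
Proof.
elim: n => [|n IHn] /=; last by rewrite IHn comeas_tens_comp.
have h : assoc 𝟏 Q2 Q1 ∘ (lunit_inv Q2 ⊠ idm Q1) = lunit_inv (Q2 ⊗ Q1) by strict C.
rewrite /coact_comp tcl (compA (assoc _ _ _)) h -!compA (lunit_inv_natural (one Q1)).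
by rewrite (compA (one Q2 ⊠ _)) -tens_split.
Qed.

Lemma comeas_pow_push (Q Q' : Mon C) (X Y : C) (f : Q ~> Q') (r : X ~> Y ⊗ Q) n :
  is_mon_hom f -> comeas_pow ((idm Y ⊠ f) ∘ r) n = (idm _ ⊠ f) ∘ comeas_pow r n.
Proof.
move=> [f1 f2]; elim: n => [|n IHn] /=.
  by rewrite -f2 !compA lunit_inv_natural.
rewrite IHn /comeas_tens tens_comp !compA -tcr f1 tcr.
by rewrite -(compA _ (swap4 _ _ _ _)) swap4_natural tens_id !compA.
Qed.

Lemma comeas_pow_runit_inv (X : C) n :
  comeas_pow (Q := unit_mon C) (runit_inv X) n = runit_inv (tpow X n).
Proof.
elim: n => [|n IHn] /=; first by rewrite compose_idr; strict C.
rewrite IHn /comeas_tens /swap4 -lock /=; change (mon_ob (unit_mon C)) with (@munit C).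
by strict C.
Qed.

Variables (Omega : Type) (s t : Omega -> nat).
Implicit Types A B E : Magma C s t.

Lemma comeasuring_comp A B E (Q1 Q2 : Mon C) (r2 : B ~> E ⊗ Q2) (r1 : A ~> B ⊗ Q1) :
  is_comeasuring r2 -> is_comeasuring r1 ->
  is_comeasuring (Q := tens_mon Q2 Q1) (coact_comp r2 r1).
Proof.
move=> h2 h1 w; rewrite !comeas_pow_comp /coact_comp /=.
rewrite -compA h1 !compA -[_ ∘ (_ ⊠ _) ∘ (_ ⊠ _)]compA -tcl h2 tcl !compA.
by rewrite assoc_natural tens_id.
Qed.

Lemma comeasuring_push A B (Q Q' : Mon C) (f : Q ~> Q') (r : A ~> B ⊗ Q) :
  is_mon_hom f -> is_comeasuring r -> is_comeasuring (Q := Q') ((idm B ⊠ f) ∘ r).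
Proof.
move=> hf hr w; rewrite !comeas_pow_push // -compA hr !compA.
by rewrite -tens_split' -tens_split.
Qed.

Lemma comeasuring_runit_inv A :
  is_comeasuring (Q := unit_mon C) (runit_inv A : A ~> A ⊗ unit_mon C).
Proof.
by move=> w; rewrite !comeas_pow_runit_inv runit_inv_natural.
Qed.
End Comeasurings.

(** * The bimonoid structure on the universal comeasuring monoid *)

Section Coaction_composition.
Variable C : SymMonCat.

Lemma coact_comp_coef (X Y Z Q1 Q2 Q1' Q2' : C) (r2 : Y ~> Z ⊗ Q2) (r1 : X ~> Y ⊗ Q1)
    (f2 : Q2 ~> Q2') (f1 : Q1 ~> Q1') :
  coact_comp ((idm Z ⊠ f2) ∘ r2) ((idm Y ⊠ f1) ∘ r1) = (idm Z ⊠ (f2 ⊠ f1)) ∘ coact_comp r2 r1.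
Proof.
rewrite /coact_comp !compA -assoc_natural -[_ ∘ _ ∘ (idm Y ⊠ f1)]compA.
rewrite -[_ ∘ ((_ ⊠ _) ⊠ _) ∘ (r2 ⊠ _)]compA -!tens_comp.
by rewrite !compose_idl !compose_idr.
Qed.

Lemma coact_comp_assoc (X Y Z W Q1 Q2 Q3 : C) (r3 : Z ~> W ⊗ Q3) (r2 : Y ~> Z ⊗ Q2)
    (r1 : X ~> Y ⊗ Q1) :
  (idm W ⊠ assoc Q3 Q2 Q1) ∘ coact_comp (coact_comp r3 r2) r1
  = coact_comp r3 (coact_comp r2 r1).
Proof.
rewrite /coact_comp !tcl !compA pentagon -[_ ∘ (r3 ⊠ _) ∘ assoc _ _ _]compA.
by rewrite -assoc_nat1 !compA.
Qed.

Lemma coact_comp_unitl (X Y Q : C) (r : X ~> Y ⊗ Q) :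
  (idm Y ⊠ lunit Q) ∘ coact_comp (runit_inv Y) r = r.
Proof.
rewrite /coact_comp !compA triangle -tcl runit_invK tens_id; exact: compose_idl.
Qed.

Lemma coact_comp_unitr (X Y Q : C) (r : X ~> Y ⊗ Q) :
  (idm Y ⊠ runit Q) ∘ coact_comp r (runit_inv X) = r.
Proof.
rewrite /coact_comp !compA runit_tens runit_natural -compA runit_invK; exact: compose_idr.
Qed.
End Coaction_composition.

Section Universal_bimonoid.
Variables (C : SymMonCat) (Omega : Type) (s t : Omega -> nat) (A : Magma C s t).

(** [B] is generated by the coefficients of its comeasuring: [(id ⊗ f) r] is again
    a comeasuring under [rhoU], and it determines [f] by initiality. *)
Lemma universal_comeasuring_inj (U : C) (rhoU : A ~> A ⊗ U) (B : Mon C) (r : A ~> A ⊗ B)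
    (Q : Mon C) (f g : B ~> Q) :
  is_universal_comeasuring rhoU r -> is_mon_hom f -> is_mon_hom g ->
  (idm A ⊠ f) ∘ r = (idm A ⊠ g) ∘ r -> f = g.
Proof.
move=> [[hr [tau ht]] univ] hf hg e.
have [|k [_ uk]] := univ Q ((idm A ⊠ f) ∘ r).
  split; first exact: comeasuring_push.
  by exists (f ∘ tau); rewrite tcr -compA ht.
rewrite -[f]/(mon_hom (Build_MonHom hf)) -[g]/(mon_hom (Build_MonHom hg)).
by rewrite -(uk (Build_MonHom hf)) // (uk (Build_MonHom hg)) //=.
Qed.

Variables (U : Comon C) (rhoU : A ~> A ⊗ U).
Hypotheses (rhoU_epi : tensor_epi rhoU) (rhoU_comodule : is_comodule rhoU).

(** The comultiplication and the counit of [B] are induced by the comeasurings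
    [(r ⊗ id) r], with values in [B ⊗ B], and [A ≅ A ⊗ 𝟏].  Both are under
    [rhoU] since [rhoU] is a comodule.  The bimonoid axioms say that these maps
    are monoid homomorphisms, and each comonoid axiom equates two monoid
    homomorphisms out of [B] which agree on the coefficients of [r].  That [tau]
    is a comonoid homomorphism can be tested on the coefficients of [rhoU], as
    [rhoU] is a tensor epimorphism. *)
Lemma universal_comeasuring_bimonoid (B : Mon C) (r : A ~> A ⊗ B) :
  is_universal_comeasuring rhoU r ->
  exists (B' : Bimon C) (r' : A ~> A ⊗ B') (tau : ComonHom U B'),
    [/\ is_universal_comeasuring rhoU r', is_coaction r' & (idm A ⊠ tau) ∘ rhoU = r'].
Proof.
(* The record is opened so that the monoid underlying the new bimonoid is
   convertible to the given one. *)
case: B r => B m u laws r univ.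
have inj := universal_comeasuring_inj univ; have [[hr [tau ht]] lift] := univ.
have [e1 e2] := rhoU_comodule.
set M := Build_Mon laws in r univ inj hr tau ht lift.
have hrr : coact_comp r r = (idm A ⊠ ((tau ⊠ tau) ∘ comul U)) ∘ rhoU.
  by rewrite -ht coact_comp_coef /coact_comp e1 !tcr !compA.
have hru : runit_inv A = (idm A ⊠ counit U) ∘ rhoU.
  by rewrite -[RHS]compose_idl -runitK -compA (compA (runit A)) e2 compose_idr.
have [|[dl dlP] [dlE _]] := lift (tens_mon M M) (coact_comp r r).
  by split; [exact: comeasuring_comp | exists ((tau ⊠ tau) ∘ comul U)].
have [|[ep epP] [epE _]] := lift (unit_mon C) (runit_inv A).
  by split; [exact: comeasuring_runit_inv | exists (counit U)].
rewrite /= in dl dlP dlE ep epP epE.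
have pid := is_mon_hom_id M.
have rr (Q2 Q1 : C) (f2 : M ~> Q2) (f1 : M ~> Q1) :
    (idm A ⊠ ((f2 ⊠ f1) ∘ dl)) ∘ r = coact_comp ((idm A ⊠ f2) ∘ r) ((idm A ⊠ f1) ∘ r).
  by rewrite coact_comp_coef tcr -compA dlE.
have r1 : (idm A ⊠ idm M) ∘ r = r by rewrite tens_id compose_idl.
have law : is_comonoid (dl : M ~> M ⊗ M) ep.
  split.
  - apply: (inj (tens_mon M (tens_mon M M))).
    + apply: (is_mon_hom_comp (B := tens_mon M M)) (dlP).
      apply: (is_mon_hom_comp (B := tens_mon (tens_mon M M) M)); first exact: is_mon_hom_assoc.
      exact: (is_mon_hom_tens (P' := tens_mon M M) dlP pid).
    + apply: (is_mon_hom_comp (B := tens_mon M M)) (dlP).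
      exact: (is_mon_hom_tens (Q' := tens_mon M M) pid dlP).
    + by rewrite -compA tcr -compA !rr dlE r1 coact_comp_assoc.
  - apply: (inj M) (pid) _.
    + apply: (is_mon_hom_comp (B := tens_mon M M)) (dlP).
      apply: (is_mon_hom_comp (B := tens_mon (unit_mon C) M)); first exact: is_mon_hom_lunit.
      exact: (is_mon_hom_tens (P' := unit_mon C) epP pid).
    + by rewrite -compA tcr -compA rr epE r1 coact_comp_unitl.
  - apply: (inj M) (pid) _.
    + apply: (is_mon_hom_comp (B := tens_mon M M)) (dlP).
      apply: (is_mon_hom_comp (B := tens_mon M (unit_mon C))); first exact: is_mon_hom_runit.
      exact: (is_mon_hom_tens (Q' := unit_mon C) pid epP).
    + by rewrite -compA tcr -compA rr epE r1 coact_comp_unitr.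
have [dlm dlo] := dlP; have [epm epo] := epP.
pose B' := @Build_Bimon C M m u dl ep laws law dlm dlo epm epo.
have tauP : is_comon_hom (P := U) (Q := B') tau.
  split; apply: rhoU_epi; rewrite tcr -compA ht.
  - by rewrite -hrr -dlE.
  - by rewrite -hru -epE.
exists B', r, (Build_ComonHom tauP); split=> //.
split=> //; split; first exact: esym dlE.
by rewrite -compA [X in runit A ∘ X]epE runit_invK.
Qed.
End Universal_bimonoid.

(** * The antipode reverses products *)

Section Antipode.
Variable C : SymMonCat.

Definition conv (P : Comon C) (Q : Mon C) (f g : P ~> Q) : P ~> Q :=
  mul Q ∘ (f ⊠ g) ∘ comul P.

Lemma convA (P : Comon C) (Q : Mon C) (f g h : P ~> Q) :
  conv f (conv g h) = conv (conv f g) h.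
Proof.
case: (comon_laws P) (mon_laws Q) => p1 _ _ [q1 _ _]; rewrite /conv.
have e1 : f ⊠ (mul Q ∘ (g ⊠ h) ∘ comul P)
    = (idm Q ⊠ mul Q) ∘ (f ⊠ (g ⊠ h)) ∘ (idm P ⊠ comul P).
  by rewrite -!tens_comp compose_idl compose_idr.
have e2 : (mul Q ∘ (f ⊠ g) ∘ comul P) ⊠ h
    = (mul Q ⊠ idm Q) ∘ ((f ⊠ g) ⊠ h) ∘ (comul P ⊠ idm P).
  by rewrite -!tens_comp compose_idl compose_idr.
rewrite e1 e2 !compA q1 -[in RHS](compA _ (assoc _ _ _)) assoc_natural -!compA.
by rewrite (compA (assoc _ _ _)) p1 !compA.
Qed.

Lemma conv_unitl (P : Comon C) (Q : Mon C) (f : P ~> Q) : conv (one Q ∘ counit P) f = f.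
Proof.
case: (comon_laws P) (mon_laws Q) => _ p2 _ [_ q2 _]; rewrite /conv.
rewrite -{1}(compose_idl f) tens_comp compA q2 tens_split' compA lunit_natural.
by rewrite -!compA (compA (lunit P)) p2 compose_idr.
Qed.

Lemma conv_unitr (P : Comon C) (Q : Mon C) (f : P ~> Q) : conv f (one Q ∘ counit P) = f.
Proof.
case: (comon_laws P) (mon_laws Q) => _ _ p3 [_ _ q3]; rewrite /conv.
rewrite -{1}(compose_idl f) tens_comp compA q3 tens_split compA runit_natural.
by rewrite -!compA (compA (runit P)) p3 compose_idr.
Qed.

Lemma conv_inverse_unique (P : Comon C) (Q : Mon C) (f g h : P ~> Q) :
  conv f g = one Q ∘ counit P -> conv g h = one Q ∘ counit P -> f = h.
Proof. by move=> l r; rewrite -(conv_unitr f) -r convA l conv_unitl. Qed.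

Lemma mul_comon_hom (B : Bimon C) : is_comon_hom (P := tens_comon B B) (Q := B) (mul B).
Proof. by split; [rewrite bim_comul_mul compA | exact: bim_counit_mul]. Qed.
Lemma one_comon_hom (B : Bimon C) : is_comon_hom (P := unit_comon C) (Q := B) (one B).
Proof. by split; [exact: bim_comul_one | exact: bim_counit_one]. Qed.

Lemma conv_precomp (P P' : Comon C) (Q : Mon C) (f g : P ~> Q) (k : P' ~> P) :
  is_comon_hom k -> conv f g ∘ k = conv (f ∘ k) (g ∘ k).
Proof. by move=> [k1 _]; rewrite /conv tens_comp -!compA k1. Qed.

Section Antipode_of_bimonoid.
Variables (H : Bimon C) (S : H ~> H).
Hypotheses (Sl : mul H ∘ (S ⊠ idm _) ∘ comul H = one H ∘ counit H)
  (Sr : mul H ∘ (idm _ ⊠ S) ∘ comul H = one H ∘ counit H).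

Lemma antipode_one : S ∘ one H = one H.
Proof.
apply: (@conv_inverse_unique (unit_comon C) H _ (one H)).
- rewrite -{2}(compose_idl (one H)) -(conv_precomp _ _ (one_comon_hom H)) /conv Sl.
  by rewrite -compA [counit H ∘ _]bim_counit_one.
- case: (mon_laws H) => _ h _.
  rewrite /conv (tens_split (one H)) compA h lunit_natural -compA.
  by congr (_ ∘ _); exact: lunit_invK.
Qed.

(** In the convolution monoid of morphisms [H ⊗ H ~> H], the left side is a left
    inverse and the right side a right inverse of the multiplication. *)
Lemma antipode_mul : S ∘ mul H = mul H ∘ (S ⊠ S) ∘ symm H H.
Proof.
apply: (@conv_inverse_unique (tens_comon H H) H _ (mul H)).
- rewrite -{2}(compose_idl (mul H)) -(conv_precomp _ _ (mul_comon_hom H)) /conv Sl.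
  by rewrite -compA [counit H ∘ _](proj2 (mul_comon_hom H)).
- case: (mon_laws H) => h1 h2 h3; rewrite /conv /=.
  have m3 : mul H ∘ (mul H ⊠ mul H)
      = mul H ∘ (idm _ ⊠ (mul H ∘ (mul H ⊠ idm _))) ∘ (idm _ ⊠ assoc_inv H H H) ∘ assoc _ _ _.
    rewrite h1 !tcr !compA -[_ ∘ _ ∘ (_ ⊠ assoc _ _ _) ∘ _]compA -tcr assoc_invK tens_id compose_idr.
    by rewrite -[RHS]compA -assoc_nat3 !compA -h1 -compA -tens_split.
  have mS : mul H ⊠ (mul H ∘ (S ⊠ S) ∘ symm H H)
      = (mul H ⊠ mul H) ∘ (idm _ ⊠ (S ⊠ S)) ∘ (idm _ ⊠ symm H H).
    by rewrite -!tens_comp !compose_idr.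
  have nS : (idm H ⊠ assoc_inv H H H) ∘ assoc _ _ _ ∘ (idm (H ⊗ H) ⊠ (S ⊠ S))
      = (idm H ⊠ ((idm H ⊠ S) ⊠ S)) ∘ (idm H ⊠ assoc_inv H H H) ∘ assoc _ _ _.
    by rewrite -compA assoc_nat3 compA -!tcr assoc_inv_natural.
  (* The product [(x_1 y_1) (S(y_2) S(x_2))] is regrouped as
     [x_1 ((y_1 S(y_2)) S(x_2))]: [T Y] moves [Y], which holds [y_1 ⊗ y_2],
     between [x_1] and [x_2]. *)
  pose T Y := (idm H ⊠ symm H Y) ∘ assoc H H Y.
  have nT Y Y' (f : Y ~> Y') : T Y' ∘ (idm _ ⊠ f) = (idm _ ⊠ (f ⊠ idm _)) ∘ T Y.
    by rewrite /T -compA assoc_nat3 !compA -!tcr symm_natural.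
  have eT : (idm H ⊠ assoc_inv H H H) ∘ assoc _ _ _ ∘ (idm _ ⊠ symm H H) ∘ swap4 H H H H = T (H ⊗ H).
    by rewrite /T /swap4 -!lock; strict C.
  have uT : (idm H ⊠ lunit H) ∘ T 𝟏 = runit (H ⊗ H).
    by rewrite /T; strict C.
  clearbody T; set X := idm H ⊠ ((idm H ⊠ S) ⊠ S) in nS.
  have key : (idm H ⊠ assoc_inv H H H) ∘ assoc _ _ _ ∘ (idm (H ⊗ H) ⊠ (S ⊠ S))
      ∘ (idm _ ⊠ symm H H) ∘ swap4 H H H H ∘ (comul H ⊠ comul H)
      = X ∘ (idm _ ⊠ (comul H ⊠ idm _)) ∘ T H ∘ (comul H ⊠ idm _).
    rewrite nS -!(compA X) eT; congr (_ ∘ _).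
    by rewrite tens_split' !compA nT.
  set Y := idm H ⊠ (mul H ∘ (mul H ⊠ idm H)) in m3.
  rewrite mS !compA m3 -!(compA (mul H ∘ Y)) key -!compA (compA X) (compA Y) /X /Y -!tcr.
  have -> : mul H ∘ (mul H ⊠ idm H) ∘ (((idm H ⊠ S) ⊠ S) ∘ (comul H ⊠ idm H))
      = S ∘ lunit H ∘ (counit H ⊠ idm H).
    rewrite -lunit_natural -[RHS]compA -tens_split' -h2 -!compA; congr (_ ∘ _).
    by rewrite -!tens_comp !compA Sr !compose_idl compose_idr.
  rewrite !tcr -!compA (compA (_ ⊠ (counit H ⊠ _))) -nT -!compA (compA _ (T 𝟏)) uT.
  rewrite -tens_split' (tens_split (comul H)) (compA (runit _)) runit_natural !compA Sr.
  rewrite -[_ ∘ counit H ∘ _]compA -runit_natural -!compA -tens_split -lunit_runit.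
  exact: erefl.
Qed.
End Antipode_of_bimonoid.
End Antipode.

(** * Bimonoid pairings and the finite dual of a Hopf monoid *)

Section Coopposite.
Variable C : SymMonCat.

Lemma is_comonoid_cop (P : Comon C) : is_comonoid (symm P P ∘ comul P) (counit P).
Proof.
case: (comon_laws P) => p1 p2 p3; split.
- have h : assoc P P P ∘ (symm P P ⊠ idm P) ∘ symm P (P ⊗ P) ∘ assoc P P P
      = (idm P ⊠ symm P P) ∘ symm (P ⊗ P) P by strict C.
  rewrite tcl tcr !compA -[_ ∘ (comul P ⊠ _) ∘ _]compA -symm_natural.
  rewrite -[_ ∘ (_ ⊠ comul P) ∘ _]compA -symm_natural !compA -h.
  by rewrite -!compA (compA (assoc _ _ _) (comul P ⊠ _)) p1.
- have h : lunit P ∘ symm P 𝟏 = runit P by exact: symm_unit.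
  by rewrite !compA -[_ ∘ _ ∘ symm P P]compA -symm_natural !compA h p3.
- have h : runit P ∘ symm 𝟏 P = lunit P by strict C.
  by rewrite !compA -[_ ∘ _ ∘ symm P P]compA -symm_natural !compA h p2.
Qed.

(** The coopposite comonoid: the antipode reverses products, so its transpose is
    a comonoid homomorphism from [cop (H°)] to [H°]. *)
Definition cop (P : Comon C) : Comon C := {| comon_laws := is_comonoid_cop P |}.
End Coopposite.

Section Bimonoid_pairings.
Variables (C : SymMonCat).

Definition bipairing (H K : Bimon C) (b : bim_ob H ⊗ bim_ob K ~> 𝟏) : Prop :=
  left_mult (M := H) (P := K) b /\ right_mult (P := H) (M := K) b.

Lemma bipairing_symm (H K : Bimon C) (b : bim_ob H ⊗ bim_ob K ~> 𝟏) :
  bipairing b -> bipairing (b ∘ symm (bim_ob K) (bim_ob H)).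
Proof. by move=> [l r]; split; [exact: right_mult_symm r | exact: left_mult_symm l]. Qed.

Lemma bipairing_precomp (H K H' K' : Bimon C) (b : bim_ob H ⊗ bim_ob K ~> 𝟏)
    (f : BimonHom H' H) (g : BimonHom K' K) :
  bipairing b -> bipairing (b ∘ (f ⊠ g)).
Proof.
move=> [l r]; split.
- exact: left_mult_precomp (bim_hom_mon f) (bim_hom_comon g) l.
- exact: right_mult_precomp (bim_hom_comon f) (bim_hom_mon g) r.
Qed.

(** A bimonoid pairing transposes convolution on one side into convolution on
    the other: both sides are
    [b(x'(h_(1)), k_(1)) b(y'(h_(2)), k_(2))]. *)
Lemma bipairing_conv (H K : Bimon C) (b : bim_ob H ⊗ bim_ob K ~> 𝟏) (x' y' : H ~> H)
    (x y : K ~> K) :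
  bipairing b -> b ∘ (idm _ ⊠ x) = b ∘ (x' ⊠ idm _) -> b ∘ (idm _ ⊠ y) = b ∘ (y' ⊠ idm _) ->
  b ∘ (idm (bim_ob H) ⊠ conv (P := K) (Q := K) x y)
  = b ∘ (conv (P := H) (Q := H) x' y' ⊠ idm (bim_ob K)).
Proof.
move=> [[l _] [r _]] ex ey.
have -> : b ∘ (conv (P := H) (Q := H) x' y' ⊠ idm (bim_ob K))
    = pair (b ∘ (x' ⊠ idm _)) (b ∘ (y' ⊠ idm _)) ∘ (comul H ⊠ comul K).
  rewrite /conv !tcl !compA l -!pair_natural tens_id -!compA; congr (_ ∘ _).
  by rewrite -!tens_comp !compose_idl !compose_idr.
have -> : b ∘ (idm (bim_ob H) ⊠ conv (P := K) (Q := K) x y)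
    = pair (b ∘ (idm _ ⊠ x)) (b ∘ (idm _ ⊠ y)) ∘ (comul H ⊠ comul K).
  rewrite /conv !tcr !compA r -!pair_natural tens_id -!compA; congr (_ ∘ _).
  by rewrite -!tens_comp !compose_idl !compose_idr.
by rewrite ex ey.
Qed.

Lemma bipairing_unit (H K : Bimon C) (b : bim_ob H ⊗ bim_ob K ~> 𝟏) :
  bipairing b ->
  b ∘ (idm (bim_ob H) ⊠ (one K ∘ counit K)) = b ∘ ((one H ∘ counit H) ⊠ idm (bim_ob K)).
Proof.
move=> [[_ l] [_ r]]; rewrite tcr tcl !compA r l.
by rewrite -!compA -tens_split -tens_split'.
Qed.

Lemma action_contract (Omega : Type) (s t : Omega -> nat) (A : Magma C s t)
    (H K : Bimon C) (b : bim_ob H ⊗ bim_ob K ~> 𝟏) (r : A ~> A ⊗ K) :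
  bipairing b -> is_coaction r -> is_action (P := H) (contract b r).
Proof.
move=> [l m] [h1 h2]; split.
- exact: (measuring_contract m h1).
- exact: (module_contract l h2).
Qed.

Lemma coaction_push (Omega : Type) (s t : Omega -> nat) (A : Magma C s t)
    (H K : Bimon C) (f : BimonHom H K) (r : A ~> A ⊗ H) :
  is_coaction r -> is_coaction (P := K) ((idm A ⊠ f) ∘ r).
Proof.
have [f1 f2] := bim_hom_comon f.
move=> [h [r1 r2]]; split; first exact: (comeasuring_push (bim_hom_mon f) h).
split.
- have := coact_comp_coef r r f f; rewrite {2}/coact_comp r1 => e.
  apply: etrans e _; rewrite compA -tcr -f1 tcr compA //.
- by rewrite !compA -[_ ∘ (idm A ⊠ _) ∘ (idm A ⊠ _)]compA -tcr f2.
Qed.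
End Bimonoid_pairings.

Section Finite_dual_pairing.
Variables (C : SymMonCat) (D : PreRigid C) (F : FiniteDual D).

Definition fdual_pairing (A : Mon C) : A ⊗ fdual F A ~> 𝟏 := uncurry (eta F A).

Lemma left_mult_fdual_pairing (A : Mon C) : left_mult (fdual_pairing A).
Proof. by apply/mon_hom_left_mult; exact: mon_homP. Qed.

Lemma bipairing_fdual_pairing (H : Bimon C) : bipairing (K := fdual_bim F H) (fdual_pairing H).
Proof.
split; first exact: left_mult_fdual_pairing.
by split; [exact: e_mul | exact: e_one].
Qed.

Lemma uncurry_kappa (A : Mon C) : uncurry (kappa F A) = fdual_pairing A ∘ symm _ _.
Proof. by rewrite /uncurry curryK. Qed.

Lemma fdual_pairing_inj (A : Mon C) (X : C) (x y : X ~> fdual F A) :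
  mono (kappa F A) -> fdual_pairing A ∘ (idm A ⊠ x) = fdual_pairing A ∘ (idm A ⊠ y) -> x = y.
Proof.
move=> km e; apply: km; apply: uncurry_inj; rewrite !uncurry_comp uncurry_kappa.
by rewrite -!compA !symm_natural !compA e.
Qed.

(** Bimonoid pairings [H ⊗ K ~> 𝟏] come from bimonoid homomorphisms [K ~> H°].
    The pairing transposes to a monoid homomorphism [H ~> K^*], which
    corresponds to a comonoid homomorphism [K ~> H°]; the latter is multiplicative
    because comonoid homomorphisms into [H°] are determined by their pairing
    with [H]. *)
Lemma bipairing_hom (H K : Bimon C) (b : bim_ob H ⊗ bim_ob K ~> 𝟏) :
  bipairing b ->
  exists g : BimonHom K (fdual_bim F H), fdual_pairing H ∘ (idm (bim_ob H) ⊠ g) = b.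
Proof.
move=> [l [r1 r2]]; pose g := fdual_tr F (lcurry D l).
have gE : fdual_pairing H ∘ (idm (bim_ob H) ⊠ g) = b.
  exact: etrans (uncurry_tr F (lcurry D l)) (uncurry_lcurry D l).
have gP := comon_homP g.
have gM : is_mon_hom (A := K) (B := fdual_bim F H) g.
  split.
  - apply: (@fdual_inj _ _ F H (tens_comon K K)).
    + exact: is_comon_hom_comp gP (mul_comon_hom K).
    + exact: is_comon_hom_comp (comon_homP (fdual_mul F H)) (is_comon_hom_tens gP gP).
    + rewrite !tcr !compA [X in X ∘ _ = _]gE [X in _ = X ∘ _]e_mul r1.
      rewrite -[X in pair X _ ∘ _]gE -[X in pair _ X ∘ _]gE -pair_natural tens_id.
      by rewrite -!compA -tens_split -tens_split'.
  - apply: (@fdual_inj _ _ F H (unit_comon C)).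
    + exact: is_comon_hom_comp gP (one_comon_hom K).
    + exact: comon_homP (fdual_one F H).
    + rewrite tcr compA [X in X ∘ _ = _]gE [RHS]e_one.
      exact: r2.
by exists (Build_BimonHom gM gP).
Qed.

(** As [S] reverses products, the pairing [e(S(h), k)] of [H] with the coopposite
    of [H°] is multiplicative in [h], so it corresponds to an endomorphism [g]
    of [H°] with [e(h, g(k)) = e(S(h), k)].  Pairing with [H] transposes the antipode axioms
    for [g] into those for [S], and since [ϰ] is a monomorphism the pairing
    with [H] separates morphisms into [H°]. *)
Lemma is_hopf_fdual (H : Bimon C) : mono (kappa F H) -> is_hopf H -> is_hopf (fdual_bim F H).
Proof.
move=> km [S [Sl Sr]]; set K := fdual_bim F H.
pose e : bim_ob H ⊗ bim_ob K ~> 𝟏 := fdual_pairing H.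
have eP : bipairing e := bipairing_fdual_pairing H.
have [[l1 l2] _] := eP.
have sw : pair e e ∘ (symm _ _ ⊠ idm _) = pair e e ∘ (idm _ ⊠ symm _ _).
  by rewrite -{2}(pair_swap e e) -compA -tens_comp symmK compose_idr.
have lS : left_mult (M := H) (P := cop K) (e ∘ (S ⊠ idm (bim_ob K))).
  split.
  - rewrite -pair_natural -(compA e) -(tcl (bim_ob K)) (antipode_mul Sl Sr).
    rewrite -(compA (mul H)) tcl compA l1 -symm_natural (tens_id (bim_ob K)) tcl.
    change (comul (cop K)) with (symm (bim_ob K) (bim_ob K) ∘ comul K).
    rewrite !compA -(compA _ _ (symm _ _ ⊠ _)) -tens_split' tens_split compA sw.
    rewrite -!compA; congr (_ ∘ _).
    by rewrite -!tens_comp !compose_idl !compose_idr.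
  - by rewrite -(compA e) -(tcl (bim_ob K)) (antipode_one Sl).
pose g : bim_ob K ~> bim_ob K := fdual_tr F (lcurry D lS).
have gE : e ∘ (idm _ ⊠ g) = e ∘ (S ⊠ idm _).
  exact: etrans (uncurry_tr F (lcurry D lS)) (uncurry_lcurry D lS).
have iE : e ∘ (idm _ ⊠ idm _) = e ∘ (idm _ ⊠ idm _) by [].
exists g; split; apply: (fdual_pairing_inj km).
- have := bipairing_conv eP gE iE; rewrite /conv Sl -(bipairing_unit eP); exact.
- have := bipairing_conv eP iE gE; rewrite /conv Sr -(bipairing_unit eP); exact.
Qed.
End Finite_dual_pairing.

(** * The universal action of the finite dual *)

Section Multiplicative_pairings.
Variable C : SymMonCat.

Lemma right_mult_pair (P1 P2 : Comon C) (M1 M2 : Mon C) (b1 : P1 ⊗ M1 ~> 𝟏) (b2 : P2 ⊗ M2 ~> 𝟏) :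
  right_mult b1 -> right_mult b2 ->
  right_mult (P := tens_comon P1 P2) (M := tens_mon M1 M2) (pair b1 b2).
Proof.
move=> [h1 o1] [h2 o2]; split; rewrite /=.
- rewrite tcr compA -{1}(tens_id P1 P2) pair_natural h1 h2 -!pair_natural.
  rewrite tcl compA pair_pair -!compA -tens_split' !tens_id.
  by rewrite -tens_split.
- rewrite tcr compA -{1}(tens_id P1 P2) pair_natural o1 o2 -!pair_natural pair_unitl.
  rewrite -!compA; congr (_ ∘ _).
  by rewrite -!tens_comp tens_id compose_idl lunit_invK compose_idr.
Qed.

Lemma right_mult_unit : right_mult (P := unit_comon C) (M := unit_mon C) (lunit 𝟏).
Proof.
split; rewrite /=.
- rewrite pair_unitl -compA -tens_comp lunit_invK.
  by rewrite compose_idr.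
- by [].
Qed.

Lemma comul_mon_hom (B : Bimon C) : is_mon_hom (A := B) (B := tens_mon B B) (comul B).
Proof. by split; [exact: bim_comul_mul | exact: bim_comul_one]. Qed.
Lemma counit_mon_hom (B : Bimon C) : is_mon_hom (A := B) (B := unit_mon C) (counit B).
Proof. by split; [exact: bim_counit_mul | exact: bim_counit_one]. Qed.
End Multiplicative_pairings.

Section Universal_action.
Variables (C : SymMonCat) (D : PreRigid C).
Hypothesis alpha_mono : forall M N : C, mono (alpha D M ⊠ idm N).
Hypothesis theta_mono : forall M N : C, mono (theta D M N).
Variables (Omega : Type) (s t : Omega -> nat) (A : Magma C s t).

Lemma dual_pairing_curry (P M : C) (b : P ⊗ M ~> 𝟏) :
  dual_pairing D P ∘ (idm P ⊠ curry D (b ∘ symm M P)) = b.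
Proof. by rewrite /dual_pairing -compA symm_natural compA curryK -compA symmK compose_idr. Qed.

Lemma vee_dual_pairing (U P X Y : C) (rho : X ~> Y ⊗ U) (tau : P ~> dual D U) :
  contract (dual_pairing D P) ((idm Y ⊠ curry D (uncurry tau ∘ symm U P)) ∘ rho)
  = vee D rho ∘ (tau ⊠ idm X).
Proof. by rewrite contract_coef dual_pairing_curry vee_scalar. Qed.

Section Universal.
Variables (U : C) (rhoU : A ~> A ⊗ U) (B : Mon C) (r : A ~> A ⊗ B).
Hypothesis r_universal : is_universal_comeasuring rhoU r.

(** A pairing multiplicative in [B] is a monoid homomorphism from [B] to [P^*], and
    these are determined by the comeasurings [A ~> A ⊗ P^*] which they induce. *)
Lemma universal_pairing_inj (P : Comon C) (p q : P ⊗ B ~> 𝟏) :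
  right_mult p -> right_mult q -> contract p r = contract q r -> p = q.
Proof.
move=> hp hq e; rewrite -(dual_pairing_curry p) -(dual_pairing_curry q); congr (_ ∘ (_ ⊠ _)).
have hom (b : P ⊗ B ~> 𝟏) : right_mult b ->
    is_mon_hom (A := B) (B := dual_mon D P) (curry D (b ∘ symm B P)).
  by move=> hb; exact: mon_homP (lcurry D (right_mult_symm hb)).
apply: (universal_comeasuring_inj r_universal (hom p hp) (hom q hq)).
apply: (@contract_dual_inj _ D P _ _ (@theta_mono _ _) (@alpha_mono _ _)).
by rewrite !contract_coef !dual_pairing_curry.
Qed.

(** The transpose of [P ~> U^*] is a morphism [U ~> P^*], along which [rhoU] induces
    a comeasuring [A ~> A ⊗ P^*] with contraction [psi]. *)
Lemma universal_pairing (P : Comon C) (psi : P ⊗ A ~> A) :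
  is_measuring psi -> (exists tau : P ~> dual D U, psi = vee D rhoU ∘ (tau ⊠ idm A)) ->
  exists2 b : P ⊗ B ~> 𝟏, right_mult b & contract b r = psi.
Proof.
move=> hpsi [tau ht]; have [_ lift] := r_universal.
have e := vee_dual_pairing rhoU tau.
have [|phi [phiE _]] := lift (dual_mon D P) ((idm A ⊠ curry D (uncurry tau ∘ symm U P)) ∘ rhoU).
  split; last by eexists.
  by apply: (comeasuring_contract alpha_mono theta_mono); rewrite e -ht.
exists (dual_pairing D P ∘ (idm P ⊠ phi)).
  exact: right_mult_precomp (is_comon_hom_id P) (mon_homP phi) (right_mult_dual_pairing D P).
by rewrite -contract_coef phiE ht.
Qed.
End Universal.

(** The pairings [b(l l', x)] and [b(l, x_(1)) b(l', x_(2))] of [L ⊗ L] with [B] are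
    both multiplicative in [B] and induce the same measuring, as [psi] is a module
    structure and [r] a comodule structure; hence they coincide.  The units are
    compared in the same way, with [L ⊗ L] replaced by [𝟏]. *)
Lemma universal_bipairing (U : C) (rhoU : A ~> A ⊗ U) (B : Bimon C) (r : A ~> A ⊗ B)
    (L : Bimon C) (psi : L ⊗ A ~> A) :
  is_universal_comeasuring (Q := B) rhoU r -> is_comodule (U := B) r ->
  is_action psi -> (exists tau : L ~> dual D U, psi = vee D rhoU ∘ (tau ⊠ idm A)) ->
  exists2 b : bim_ob L ⊗ bim_ob B ~> 𝟏, bipairing b & contract b r = psi.
Proof.
move=> univ [r1 r2] [meas [act1 act2]] over.
have [b hb bE] := universal_pairing univ meas over; exists b => //; split=> //; split.
- apply: (universal_pairing_inj univ (P := tens_comon L L)).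
  + exact: right_mult_precomp (mul_comon_hom L) (is_mon_hom_id B) hb.
  + exact: right_mult_precomp (is_comon_hom_id (tens_comon L L)) (comul_mon_hom B)
      (right_mult_pair hb hb).
  + by rewrite contract_scalar bE -contract_coef -r1 contract_comp bE.
- apply: (universal_pairing_inj univ (P := unit_comon C)).
  + exact: right_mult_precomp (one_comon_hom L) (is_mon_hom_id B) hb.
  + exact: right_mult_precomp (is_comon_hom_id (unit_comon C)) (counit_mon_hom B)
      (right_mult_unit C).
  + rewrite contract_scalar bE act2 -contract_coef.
    have -> : (idm A ⊠ counit B) ∘ r = runit_inv A.
      by rewrite -[LHS]compose_idl -runitK -compA (compA (runit A)) r2 compose_idr.
    by rewrite contract_unit.
Qed.

Variable F : FiniteDual D.
Hypothesis kappa_mono : forall H : Hopf C, mono (kappa F H).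

Lemma hopf_fdual (H : Hopf C) : is_hopf (fdual_bim F H).
Proof. exact: is_hopf_fdual (@kappa_mono H) (hopf_antipode H). Qed.

Definition fdual_hopf (H : Hopf C) : Hopf C := Build_Hopf (hopf_fdual H).

Variables (U : Comon C) (rhoU : A ~> A ⊗ U).
Hypotheses (rhoU_epi : tensor_epi rhoU) (rhoU_comodule : is_comodule rhoU).
Variables (B0 : Mon C) (r0 : A ~> A ⊗ B0).
Hypothesis r0_universal : is_universal_comeasuring rhoU r0.
Variables (HU : Hopf C) (rhoH : A ~> A ⊗ HU).
Hypothesis rhoH_universal : is_universal_hopf_coaction rhoU rhoH.

Let copairing : bim_ob (fdual_bim F HU) ⊗ bim_ob HU ~> 𝟏 := fdual_pairing F HU ∘ symm _ _.
Let psi : fdual_bim F HU ⊗ A ~> A := vee D rhoH ∘ (kappa F HU ⊠ idm A).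

Lemma fdual_actionE : psi = contract copairing rhoH.
Proof. by rewrite /psi vee_scalar uncurry_kappa. Qed.

Lemma bipairing_copairing : bipairing copairing.
Proof. exact: bipairing_symm (bipairing_fdual_pairing F HU). Qed.

Lemma fdual_action_over :
  hopf_action_over (V := dual_mon D U) (H := fdual_hopf HU) (vee D rhoU) psi.
Proof.
have [[hr [tau ht]] _] := rhoH_universal; split.
  by rewrite fdual_actionE; exact: action_contract bipairing_copairing hr.
have [l _] := bipairing_copairing.
have l' : left_mult (M := fdual_bim F HU) (P := U) (copairing ∘ (idm _ ⊠ tau)).
  exact: left_mult_precomp (is_mon_hom_id _) (comon_homP tau) l.
by exists (lcurry D l'); rewrite vee_scalar uncurry_lcurry -contract_coef ht fdual_actionE.
Qed.

Lemma fdual_action_comp (L : Hopf C) (g : BimonHom L (fdual_bim F HU)) :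
  psi ∘ (g ⊠ idm A) = contract (fdual_pairing F HU ∘ (idm (bim_ob HU) ⊠ g) ∘ symm _ _) rhoH.
Proof. by rewrite fdual_actionE -contract_scalar /copairing -!compA symm_natural. Qed.

(** The bimonoid homomorphism [B ~> L°] given by the universal bimonoid [B] makes
    the Hopf monoid [L°] coact on [A], so it yields [H ~> L°], whose transpose is
    the required [L ~> H°]. *)
Lemma fdual_action_lift (L : Hopf C) (psiL : L ⊗ A ~> A) :
  hopf_action_over (V := dual_mon D U) (vee D rhoU) psiL ->
  exists g : BimonHom L (fdual_bim F HU), psi ∘ (g ⊠ idm A) = psiL.
Proof.
move=> [act [tau tauE]].
have [B [r [tauB [univ coact tauBE]]]] :=
  universal_comeasuring_bimonoid rhoU_epi rhoU_comodule r0_universal.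
have [|b hb bE] := universal_bipairing univ (proj2 coact) act; first by exists tau.
have [g1 g1E] := bipairing_hom F hb.
have [|ga [gaE _]] := proj2 rhoH_universal (fdual_hopf L) ((idm A ⊠ g1) ∘ r).
  split; first exact: (coaction_push g1 coact).
  by exists (comon_hom_comp (Build_ComonHom (bim_hom_comon g1)) tauB); rewrite -tauBE compA -tcr.
have [g gE] := bipairing_hom F (bipairing_symm
  (bipairing_precomp (bim_hom_id L) ga (bipairing_fdual_pairing F L))).
exists g; rewrite fdual_action_comp gE -compA symmK compose_idr.
by rewrite -contract_coef gaE contract_coef [X in contract X r]g1E.
Qed.

(** Let [k], [k'] be the transposes [HU ~> L°] of [g], [g'], and [la : B0 ~> HU] the
    homomorphism with [(id ⊗ la) r0 = rhoH].  Then [k ∘ la = k' ∘ la], since the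
    pairings of [L] with [B0] are determined by their contractions and [ϰ_L] is a
    monomorphism.  Hence [k] and [k'] induce the same coaction, and universality
    of [HU] gives [k = k']. *)
Lemma fdual_action_inj (L : Hopf C) (g g' : BimonHom L (fdual_bim F HU)) :
  psi ∘ (g ⊠ idm A) = psi ∘ (g' ⊠ idm A) -> g = g'.
Proof.
rewrite !fdual_action_comp => e.
have [[coactH [tauH tauHE]] lift] := rhoH_universal.
have [[la laP] [laE _]] : exists! la : MonHom B0 HU, (idm A ⊠ la) ∘ r0 = rhoH.
  by apply: (proj2 r0_universal); split; [exact: proj1 coactH | exists tauH].
have transp (k : BimonHom L (fdual_bim F HU)) : exists k' : BimonHom HU (fdual_hopf L),
    fdual_pairing F L ∘ (idm (bim_ob L) ⊠ k')
    = fdual_pairing F HU ∘ (idm (bim_ob HU) ⊠ k) ∘ symm _ _.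
  apply: bipairing_hom; apply: bipairing_symm.
  exact: bipairing_precomp (bim_hom_id HU) k (bipairing_fdual_pairing F HU).
have [[k kE] [k' k'E]] := (transp g, transp g').
have mult (h : BimonHom HU (fdual_hopf L)) :
    right_mult (P := L) (M := B0) (fdual_pairing F L ∘ (idm (bim_ob L) ⊠ (h ∘ la))).
  have [_ m] := bipairing_fdual_pairing F L.
  exact: (right_mult_precomp (is_comon_hom_id L) (is_mon_hom_comp (bim_hom_mon h) laP) m).
have restr (h : BimonHom HU (fdual_hopf L)) :
    contract (fdual_pairing F L ∘ (idm (bim_ob L) ⊠ (h ∘ la))) r0
    = contract (fdual_pairing F L ∘ (idm (bim_ob L) ⊠ h)) rhoH.
  by rewrite tcr compA -contract_coef laE.
have kla : k ∘ la = k' ∘ la.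
  apply: (fdual_pairing_inj (@kappa_mono L)).
  by apply: (universal_pairing_inj r0_universal (mult k) (mult k')); rewrite !restr kE k'E.
have push : (idm A ⊠ k) ∘ rhoH = (idm A ⊠ k') ∘ rhoH.
  by rewrite -laE !compA -!tcr /= kla.
have [|h [_ hU]] := lift (fdual_hopf L) ((idm A ⊠ k) ∘ rhoH).
  split; first exact: (coaction_push k coactH).
  by exists (comon_hom_comp (Build_ComonHom (bim_hom_comon k)) tauH); rewrite -tauHE compA -tcr.
have kk : k = k' by rewrite -(hU k) // (hU k').
apply: bim_hom_eq; apply: (fdual_pairing_inj (@kappa_mono HU)).
rewrite -[LHS]compose_idr -[RHS]compose_idr -(symmK (bim_ob HU) (bim_ob L)) !compA.
by rewrite -kE -k'E kk.
Qed.

Lemma fdual_action_universal :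
  is_universal_hopf_action (V := dual_mon D U) (H := fdual_hopf HU) (vee D rhoU) psi.
Proof.
split=> [|L psiL /fdual_action_lift [g gE]]; first exact: fdual_action_over.
by exists g; split=> // g' g'E; apply: fdual_action_inj; rewrite gE.
Qed.
End Universal_action.

Lemma universal_hopf_action_iso (C : SymMonCat) (Omega : Type) (s t : Omega -> nat)
    (A : Magma C s t) (V : Mon C) (psiV : V ⊗ A ~> A) (H K : Hopf C) (psi : H ⊗ A ~> A)
    (phi : K ⊗ A ~> A) :
  is_universal_hopf_action psiV psi -> is_universal_hopf_action psiV phi ->
  exists beta : (H : HOPF C) ~> (K : HOPF C),
    unique (fun b : BimonHom H K => phi ∘ (b ⊠ idm A) = psi) beta /\ is_iso beta.
Proof.
move=> [over_psi univ_psi] [over_phi univ_phi].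
have [b bU] := univ_phi H psi over_psi; exists b; split=> //.
have [d [dE _]] := univ_psi K phi over_phi; have [bE _] := bU.
have [i [_ iU]] := univ_psi H psi over_psi; have [j [_ jU]] := univ_phi K phi over_phi.
exists d; split.
- transitivity i; last by apply: iU; rewrite /= tens_id compose_idr.
  by apply: esym; apply: iU; rewrite /= tcl compA dE.
- transitivity j; last by apply: jU; rewrite /= tens_id compose_idr.
  by apply: esym; apply: jU; rewrite /= tcl compA bE.
Qed.

Theorem theorem3p35
  (C : SymMonCat) (D : PreRigid C)
  (F : FiniteDual D)
  (Hl Hr : Functor (BIMON C) (HOPF C))
  (Hl_adj : Adjunction Hl (hopf_incl C))
  (Hr_adj : Adjunction (hopf_incl C) Hr)
  (alpha_mono : forall M N : C, mono (alpha D M ⊠ idm N))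
  (theta_mono : forall M N : C, mono (theta D M N))
  (kappa_mono : forall H : Hopf C, mono (kappa F H))
  (Omega : Type) (s t : Omega -> nat) (A : Magma C s t)
  (U : Comon C) (rhoU : A ~> A ⊗ U)
  (rhoU_epi : tensor_epi rhoU) (rhoU_comodule : is_comodule rhoU)
  (comeas_monoid_exists : exists (Q : Mon C) (rho : A ~> A ⊗ Q),
     is_universal_comeasuring rhoU rho)
  (meas_comonoid_exists : exists (P : Comon C) (psi : P ⊗ A ~> A),
     is_universal_measuring (vee D rhoU) psi)
  (HU : Hopf C) (rhoH : A ~> A ⊗ HU)
  (rhoH_universal : is_universal_hopf_coaction rhoU rhoH)
  (HV : Hopf C) (psiH : HV ⊗ A ~> A)
  (psiH_universal :
     is_universal_hopf_action (V := dual_mon D U) (vee D rhoU) psiH) :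
  exists HUo_hopf : is_hopf (fdual_bim F HU),
    let HUo : HOPF C := {| hopf_antipode := HUo_hopf |} in
    let psi : fdual_bim F HU ⊗ A ~> A := vee D rhoH ∘ (kappa F HU ⊠ idm A) in
    is_action psi /\
    exists beta : HUo ~> (HV : HOPF C),
      unique (fun b : BimonHom (fdual_bim F HU) HV => psiH ∘ (b ⊠ idm A) = psi) beta /\
      is_iso beta.
Proof.
exists (hopf_fdual kappa_mono HU).
have [B [r B_universal]] := comeas_monoid_exists.
have univ := fdual_action_universal alpha_mono theta_mono kappa_mono rhoU_epi rhoU_comodule
  B_universal rhoH_universal.
by split; [exact: proj1 (proj1 univ) | exact: universal_hopf_action_iso univ psiH_universal].
Qed.
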